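(* Given a positive integer $t$, let $w_1,\ldots,w_t$ be $t$ fixed integers such that $\min\{w_i\mid 1\le i\le t\}\ge 2$. Denote $u=\sum_{i=1}^t w_i$. Let $\mathcal{F}$ be an $SHF(N;n,t,\{w_1,\ldots,w_t\})$ such that $n$ is sufficiently large compared with the $w_i$'s. Then the following two statements hold. (a) Denote $$p^*=\max_{\sum_{i=1}^t p_i=1,\ 0\le p_i\le 1}\ \sum_{\pi\in S_t}\prod_{i=1}^t p_{\pi(i)}^{w_i-1}\quad\text{and}\quad g(t,j+1)=\frac{t(t-1)\cdots(t-j)}{t^{j+1}},$$ where $S_t$ denotes the symmetric group on a finite set of $t$ elements. Then $$C(N,t,\{w_1,\ldots,w_t\})\le C(p^*N,t,\{1,\ldots,1\})+u-t\le \min_{0\le j\le t-2}(t-j-1)\Big(\frac{t-j}{t-j-1}\Big)^{g(t,j+1)p^*N}+u-t.$$ (b) For $w_1=\cdots=w_t=w\ge 2$, $$C(N,t,\{w,\ldots,w\})\le C\Big(t!\big(\tfrac1t\big)^{t(w-1)}N,\,t,\{1,\ldots,1\}\Big)+u-t\le\min\Big\{2^{\frac{(t!)^2N}{t^{tw-1}}},\ (t-1)\Big(\frac{t}{t-1}\Big)^{\frac{t!\,N}{t^{tw-t}}}\Big\}+u-t.$$ In both parts, $\{1,\ldots,1\}$ has $t$ ones.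
   Context: An $SHF(N;n,q,\{w_1,\ldots,w_t\})$ (separating hash family of type $\{w_1,\ldots,w_t\}$, a multiset of positive integers) is an $N\times n$ matrix over an alphabet of $q$ symbols such that for any pairwise disjoint sets $C_1,\ldots,C_t$ of columns with $|C_i|=w_i$ for $1\le i\le t$ there is a row in which the sets of entries of $C_1,\ldots,C_t$ are pairwise disjoint. $C(N,q,\{w_1,\ldots,w_t\})$ denotes the maximal $n$ such that there exists an $SHF(N;n,q,\{w_1,\ldots,w_t\})$. Here the alphabet size $q$ equals $t$, the number of parts. The bound is derived using the asymptotic $\binom{n}{w}\approx\frac{n^w}{w!}$ (with $w$ the largest of the $w_i$'s), which is why $n$ is taken sufficiently large compared with the $w_i$'s. *)

(* Defs.v *)
From mathcomp Require Import all_boot all_order all_algebra all_fingroup.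
From mathcomp Require Import zify.
From mathcomp Require Import all_classical all_reals all_analysis.

Set Implicit Arguments.
Unset Strict Implicit.
Unset Printing Implicit Defensive.

Import Order.TTheory GRing.Theory Num.Theory.
Import numFieldNormedType.Exports.

Local Open Scope ring_scope.

(* An SHF(N; n, q, {w_1, ..., w_t}). The multiset of part sizes is given as an
   indexed family, whose order is irrelevant. *)
Definition is_SHF (N n q t : nat) (w : 'I_t -> nat) (A : 'M['I_q]_(N, n)) :
    Prop :=
  forall C : 'I_t -> {set 'I_n},
    (forall i, #|C i| = w i) ->
    (forall i j, i != j -> [disjoint C i & C j]) ->
    exists r : 'I_N, forall i j, i != j ->
      [disjoint A r @: C i & A r @: C j].

Lemma disjoint_family (T : finType) (t : nat) (w : 'I_t -> nat)
    (s : seq 'I_t) (X : {set T}) :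
  uniq s -> (\sum_(i <- s) w i <= #|X|)%N ->
  exists C : 'I_t -> {set T},
    [/\ forall i, i \in s -> #|C i| = w i, forall i, C i \subset X
      & forall i j, i != j -> [disjoint C i & C j]].
Proof.
elim: s X => [|a s IH] X /= us hX.
  exists (fun=> finset.set0); split=> // [i|i j _]; first exact: finset.sub0set.
  by rewrite finset.disjoints_subset finset.sub0set.
move: hX us; rewrite big_cons => hX /andP[as_ us].
pose Y := finset (mem (take (w a) (enum X))).
have YX : Y \subset X.
  by apply/fintype.subsetP => x; rewrite inE => /mem_take; rewrite mem_enum.
have cY : #|Y| = w a.
  rewrite cardsE (card_uniqP _) ?take_uniq ?enum_uniq//.
  rewrite size_take -cardE; case: ltnP => // h.
  by apply/eqP; rewrite eqn_leq h (leq_trans (leq_addr _ _) hX).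
have [|C [C1 C2 C3]] := IH (X :\: Y)%SET us.
  rewrite cardsD (finset.setIidPr YX) cY; lia.
have dY i : [disjoint Y & C i].
  rewrite disjoint_sym finset.disjoints_subset.
  by apply: (fintype.subset_trans (C2 i)); rewrite finset.setDE finset.subsetIr.
exists (fun i => if i == a then Y else C i); split.
- move=> i; rewrite inE; have [->|_] //= := eqVneq i a; exact: C1.
- move=> i; have [_|_] // := eqVneq i a.
  exact: fintype.subset_trans (C2 i) (finset.subsetDl _ _).
- move=> i j; case: (eqVneq i a) => [-> /=|_]; case: (eqVneq j a) => //= _ ij.
    by rewrite disjoint_sym.
  exact: C3.
Qed.

Lemma SHF_bounded (N n q t : nat) (w : 'I_t -> nat) (A : 'M['I_q]_(N, n)) :
  (2 <= t)%N -> (forall i, 0 < w i)%N -> is_SHF w A ->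
  (n <= #|{: 'cV['I_q]_N}| * \sum_(i < t) w i)%N.
Proof.
move=> t2 w0 SA; rewrite leqNgt; apply/negP => ltn.
have [v hv] : exists v : 'cV['I_q]_N,
    (\sum_(i < t) w i <= #|[set c | col c A == v]%SET|)%N.
  apply/existsP; apply: contraLR ltn => /existsPn h; rewrite -leqNgt.
  rewrite -[X in (X <= _)%N]card_ord -sum1_card.
  rewrite (partition_big (fun c => col c A) xpredT)//=.
  rewrite -sum_nat_const; apply: leq_sum => v _.
  rewrite sum1dep_card.
  by have := h v; rewrite -ltnNge => /ltnW.
have [|C [C1 C2 C3]] := disjoint_family (enum_uniq 'I_t) (X := [set c | col c A == v]%SET) (w := w).
  by rewrite big_enum.
have [r hr] := SA C (fun i => C1 i (mem_enum 'I_t i)) C3.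
pose i0 := Ordinal (ltnW t2); pose i1 := Ordinal t2.
have el i : v r ord0 \in A r @: C i.
  have /card_gt0P[c cC] : (0 < #|C i|)%N by rewrite C1 ?mem_enum.
  apply/imsetP; exists c => //.
  have := fintype.subsetP (C2 i) _ cC; rewrite inE => /eqP <-.
  by rewrite mxE.
have /pred0P/(_ (v r ord0)) := hr i0 i1 isT.
by rewrite /= !el.
Qed.

Local Open Scope classical_set_scope.

(* C(N, q, {w_1, ..., w_t}). It is a maximum when t >= 2 (maxcols_max). For
   t = 1 and N > 0 every matrix with entries in 'I_q qualifies, and the value
   is then +oo (if q > 0). *)
Definition maxcols (R : realType) (N q t : nat) (w : 'I_t -> nat) : \bar R :=
  ereal_sup [set n%:R%:E | n in
    [set n : nat | exists A : 'M['I_q]_(N, n), is_SHF w A]].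

(* C(x, q, {w_1, ..., w_t}) for a real x >= 0: "at most x rows" means at most
   floor(x) rows. *)
Definition maxcolsr (R : realType) (x : R) (q t : nat) (w : 'I_t -> nat) :
    \bar R :=
  maxcols R (Num.truncn x) q w.

Definition simplex (R : realType) (t : nat) : set ('I_t -> R) :=
  [set p | \sum_(i < t) p i = 1 /\ forall i, 0 <= p i <= 1].

Definition sepfrac (R : realType) (t : nat) (w : 'I_t -> nat)
    (p : 'I_t -> R) : R :=
  \sum_(s : {perm 'I_t}) \prod_(i < t) p (s i) ^+ (w i - 1).

(* p^* ; the supremum is attained (pstar_max). *)
Definition pstar (R : realType) (t : nat) (w : 'I_t -> nat) : R :=
  sup [set sepfrac w p | p in @simplex R t].

(* g(t, k) = t (t - 1) ... (t - k + 1) / t ^ k *)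
Definition gfrac (R : realType) (t k : nat) : R :=
  (t ^_ k)%:R / t%:R ^+ k.

Lemma maxcols_max (R : realType) (N q t : nat) (w : 'I_t -> nat) :
  (2 <= t)%N -> (forall i, 0 < w i)%N ->
  exists m : nat, [/\ maxcols R N q w = m%:R%:E,
    exists A : 'M['I_q]_(N, m), is_SHF w A &
    forall n (A : 'M['I_q]_(N, n)), is_SHF w A -> (n <= m)%N].
Proof.
move=> t2 w0.
pose P n := `[< exists A : 'M['I_q]_(N, n), is_SHF w A >].
have P0 : exists n, P n.
  exists 0%N; apply/asboolP.
  have e : forall (r : 'I_N) (j : 'I_0), 'I_q by move=> _ [].
  exists (\matrix_(r, j) e r j) => C hC.
  have := hC (Ordinal (ltnW t2)); have := w0 (Ordinal (ltnW t2)).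
  by move=> + E; rewrite -E => /card_gt0P[[]].
have bP n : P n -> (n <= #|{: 'cV['I_q]_N}| * \sum_(i < t) w i)%N.
  by move=> /asboolP[A]; exact: SHF_bounded.
case: (ex_maxnP P0 bP) => m /asboolP mP mx; exists m; split=> //.
  apply/eqP; rewrite eq_le; apply/andP; split.
    apply: ge_ereal_sup => _ [n nP <-]; rewrite lee_fin ler_nat; apply: mx.
    exact/asboolP.
  by apply: ereal_sup_ubound; exists m.
by move=> n A SA; apply: mx; apply/asboolP; exists A.
Qed.

Lemma pstar_max (R : realType) (t : nat) (w : 'I_t -> nat) :
  (0 < t)%N ->
  exists2 p : 'I_t -> R, simplex p & pstar R w = sepfrac w p /\
    forall p' : 'I_t -> R, simplex p' -> sepfrac w p' <= sepfrac w p.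
Proof.
move=> t0.
have cf i : continuous (fun v : 'rV[R]_t => v ord0 i).
  exact: coord_continuous.
have cs : continuous (fun v : 'rV[R]_t => \sum_(i < t) v ord0 i).
  by apply: continuous_big => [|i _]; [exact: add_continuous|exact: cf].
pose K : set 'rV[R]_t := [set v | simplex (fun i => v ord0 i)].
have cK : compact K.
  have -> : K = [set v : 'rV[R]_t | forall i, `[0, 1]%classic (v ord0 i)] `&`
      (fun v : 'rV[R]_t => \sum_(i < t) v ord0 i) @^-1` [set 1].
    apply/seteqP; split=> v /=.
      by case=> h1 h2; split=> // i; rewrite /= in_itv /= h2.
    by case=> h1 h2; split=> // i; move: (h1 i); rewrite /= in_itv.
  apply: compact_closedI.
    apply: (@rV_compact R t (fun=> `[0, 1]%classic)) => i.
    exact: segment_compact.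
  by apply: preimage_closed => [v _|]; [exact: cs|exact: closed_eq].
have K0 : K !=set0.
  exists (\row_i (i == Ordinal t0)%:R); split.
    under eq_bigr do rewrite mxE.
    by rewrite (bigD1 (Ordinal t0))//= big1 ?addr0// => i /negbTE ->.
  by move=> i; rewrite mxE; case: (i == _); rewrite /= ?ler01 ?lexx.
have cF : continuous (fun v : 'rV[R]_t => sepfrac w (fun i => v ord0 i)).
  apply: continuous_big => [|s _]; first exact: add_continuous.
  apply: continuous_big => [|i _]; first exact: mul_continuous.
  by move=> v; exact: (continuous_comp (cf _ v) (@exprn_continuous _ _ _)).
have [v /set_mem vK vm] := compact_EVT_max K0 cK (continuous_subspaceT cF).
have mx p' : simplex p' -> sepfrac w p' <= sepfrac w (fun i => v ord0 i).
  move=> hp; have E : (fun i => (\row_j p' j) ord0 i) = p'.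
    by apply/funext => i; rewrite mxE.
  by have := vm (\row_j p' j); rewrite E; apply; rewrite inE /K /= E.
exists (fun i => v ord0 i) => //; split=> //.
apply/eqP; rewrite eq_le; apply/andP; split.
  apply: ge_sup; first by exists (sepfrac w (fun i => v ord0 i)); exists (fun i => v ord0 i).
  by move=> _ [p hp <-]; exact: mx.
apply: ub_le_sup; last by exists (fun i => v ord0 i).
by exists (sepfrac w (fun i => v ord0 i)) => _ [p hp <-]; exact: mx.
Qed.

(* Main.v *)
(* Delete a tuple of sum_i (w_i - 1) columns, w_i - 1 of them for each part: the
   rows separating it, restricted to the other columns, form an SHF of type
   {1, ..., 1}. A uniformly random tuple is separated in at most
   p^* N (1 + O(1/n)) rows on average; the error is absorbed exactly by drawing
   the tuple from columns that agree in one row, which loses that row, so that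
   some tuple is separated in at most p^* N rows as soon as n is large compared
   with N. The last condition may be assumed, since C(m, t, {1, ..., 1})
   grows superlinearly in m.

   For type {1, ..., 1}, fix j columns x. Deleting the lightest of the k = t - j
   remaining colours, row by row, bounds the sum over v outside x of
   (1 - 1/k)^d(x, v) by k - 1, where d(x, v) counts the rows that are injective
   on x and v. The average of d is at most g(t, j+1) m, up to lower order terms.
   To get the bound without error terms a gain is needed: for j >= 2 either the
   rows are unbalanced, and the average of d is smaller, or one draws x from
   columns agreeing in one row, which costs little elsewhere because the rows
   are balanced. The case j = 0 is exact, and its bound is exponentially smaller
   than the one for j = 1. *)
Require Import Defs.
From mathcomp Require Import all_boot all_order all_algebra all_fingroup.
From mathcomp Require Import all_classical all_reals all_analysis.
From mathcomp Require Import zify ring lra.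

Set Implicit Arguments.
Unset Strict Implicit.
Unset Printing Implicit Defensive.

Import Order.TTheory GRing.Theory Num.Theory.

Local Open Scope ring_scope.

(** * Lower bound for type {1, ..., 1} *)

Lemma ffact_le_expn (n s : nat) : (n ^_ s <= n ^ s)%N.
Proof.
elim: s => // s IH; rewrite ffactnSr expnSr.
exact: leq_mul IH (leq_subr _ _).
Qed.

(** A random [s]-tuple from [n] elements has a repetition with probability at most [s ^ 2 / n];
    multiplying by [n] keeps this within the natural numbers. *)
Lemma ge_ffact_expn (n s : nat) :
  (n * n ^ s <= n * n ^_ s + s ^ 2 * n ^ s)%N.
Proof.
elim: s => [|s IH]; first by rewrite !expn0 !ffactn0; lia.
have le := ffact_le_expn n s.
rewrite expnS ffactnSr.
have H : (n * n ^_ s <= n ^_ s * (n - s) + s * n ^_ s)%N.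
  rewrite [(s * _)%N]mulnC -mulnDr mulnC leq_mul2l; apply/orP; right; lia.
set a := (n ^ s)%N in IH le *; set b := (n ^_ s)%N in IH le H *.
have H1 : (n * (n * a) <= n * (n * b) + n * (s ^ 2 * a))%N.
  by rewrite -mulnDr leq_mul2l IH orbT.
have H2 : (n * (n * b) <= n * (b * (n - s)) + n * (s * a))%N.
  rewrite -mulnDr leq_mul2l; apply/orP; right.
  by apply: leq_trans H _; rewrite leq_add2l leq_mul2l le orbT.
have E : (s.+1 ^ 2 * (n * a) = n * (s * a) + n * (s ^ 2 * a) + n * ((s + 1) * a))%N.
  by rewrite -addn1; ring.
rewrite E; lia.
Qed.

(** The term of degree [d.+1] in the exponential series of [m * ln a] outgrows [C * m ^ d]: beyond
    [K] the extra factor [m] pays for all constants. *)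
Lemma natmul_exp_le (R : realType) (a C : R) (d : nat) : 1 < a ->
  exists m0 : nat, forall m, (m0 <= m)%N -> C * m%:R ^+ d <= a ^+ m.
Proof.
move=> a1; have la : 0 < ln a by rewrite ln_gt0.
have a0 : 0 < a by lra.
pose K := `|C| * d.+1`!%:R / ln a ^+ d.+1.
exists (Num.truncn K).+1 => m hm.
have mK : K <= m%:R.
  by apply: (le_trans (ltW (truncnS_gt K))); rewrite ler_nat.
have -> : a ^+ m = expR (m%:R * ln a) by rewrite expRM_natl lnK ?posrE.
have h0 : 0 <= m%:R * ln a by rewrite mulr_ge0// ltW.
have fp : 0 < d.+1`!%:R :> R by rewrite ltr0n fact_gt0.
apply: (le_trans (y := `|C| * m%:R ^+ d)).
  by rewrite ler_wpM2r ?exprn_ge0// ler_norm.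
apply: (le_trans (y := (m%:R * ln a) ^+ d.+1 / d.+1`!%:R)).
- rewrite ler_pdivlMr// exprMn exprS.
  have := mK; rewrite /K ler_pdivrMr ?exprn_gt0// => h.
  have := ler_wpM2l (exprn_ge0 d (ler0n R m)) h.
  by set x := m%:R ^+ d; set y := ln a ^+ _; set z := _`!%:R; lra.
- by apply: le_trans (expR_ge1Dxn d h0); rewrite lerDr.
Qed.

Lemma SHF_ones_of_injective (N n q t : nat) (A : 'M['I_q]_(N, n)) :
  (forall c : 'I_t -> 'I_n, injective c ->
     exists r, injective (fun i => A r (c i))) ->
  is_SHF (fun _ : 'I_t => 1%N) A.
Proof.
move=> H C C1 C2.
have /choice[c cE] : forall i, exists x, C i = [set x]%SET.
  by move=> i; apply/cards1P; rewrite C1.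
have ci : injective c.
  move=> i i' e; apply/eqP; apply/negPn/negP => ne.
  have := C2 _ _ ne; rewrite !cE e => /pred0P/(_ (c i')).
  by rewrite /= inE eqxx.
have [r rP] := H c ci; exists r => i i' ne.
rewrite !cE !imset_set1 disjoints1 inE.
by apply: contra ne => /eqP/rP->.
Qed.

Lemma uniq_row_of_SHF_ones (N n q t : nat) (A : 'M['I_q]_(N, n)) (s : seq 'I_n) :
  (0 < t)%N -> is_SHF (fun _ : 'I_t => 1%N) A -> uniq s -> size s = t ->
  exists r, uniq [seq A r c | c <- s].
Proof.
move=> t0 SA us ss.
have [c0 _] : exists c0 : 'I_n, true.
  by case: s us ss => [_ /= e|c0 ? _ _]; [move: t0; rewrite -e | exists c0].
pose c (i : 'I_t) := nth c0 s i.
have ci : injective c.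
  by move=> i i' /eqP; rewrite nth_uniq ?ss// => /eqP/val_inj.
have [||r rP] := SA (fun i => [set c i]%SET).
- by move=> i; rewrite cards1.
- by move=> i i' ne; rewrite disjoints1 inE; apply: contra ne => /eqP/ci->.
exists r; apply/(uniqP (A r c0)) => i i'; rewrite !inE size_map ss => hi hi'.
rewrite !(nth_map c0) ?ss// => e; apply/eqP/negPn/negP => ne.
have /(rP (Ordinal hi) (Ordinal hi')) : Ordinal hi != Ordinal hi' by [].
by rewrite !imset_set1 disjoints1 inE /c /= e eqxx.
Qed.

(** The [t] values on the image of [c] are forced, the other [n - t] are free. The factor [t ^ t]
    avoids a subtraction in the exponent. *)
Lemma card_ffun_extending (n t : nat) (c : 'I_t -> 'I_n) : injective c ->
  (t ^ t * #|[set g : {ffun 'I_n -> 'I_t} | [forall i, g (c i) == i]]%SET|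
   = t ^ n)%N.
Proof.
move=> ci.
pose F y := [pred a : 'I_t | [forall i, (c i == y) ==> (a == i)]].
have -> : #|[set g : {ffun 'I_n -> 'I_t} | [forall i, g (c i) == i]]%SET|
    = #|family F|.
  apply: eq_card => g; rewrite inE; apply/forallP/familyP => [H y|H i].
    by apply/forallP => i; apply/implyP => /eqP <-.
  by have /forallP/(_ i)/implyP/(_ (eqxx _)) := H (c i).
rewrite card_family foldrE big_map big_enum /=.
have cF i : #|F (c i)| = 1%N.
  rewrite -(card1 i); apply: eq_card => a; apply/forallP/eqP => [/(_ i)|-> k].
    by rewrite eqxx => /eqP.
  by apply/implyP => /eqP/ci ->.
have cF' y : y \notin codom c -> #|F y| = t.
  move=> hy; rewrite -[RHS](card_ord t); apply: eq_card => a; apply/forallP => i.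
  by apply/implyP => /eqP e; move: hy; rewrite -e codom_f.
rewrite (bigID (mem (codom c)))/= [X in (_ * (X * _))%N]big1; last first.
  by move=> y /codomP[i ->]; exact: cF.
rewrite (eq_bigr (fun=> t)) => [|y /cF'//].
rewrite mul1n prod_nat_const -expnD; congr (_ ^ _)%N.
have := cardC (mem (codom c)); rewrite card_codom// card_ord => e.
by apply: etrans e _; exact: card_ord.
Qed.

(* A uniformly random row maps the tuple [c] to [(0, ..., t - 1)] with
   probability [t ^- t]. *)
Lemma exists_good_row (n t : nat) (U : {set {ffun 'I_t -> 'I_n}}) :
  (0 < t)%N -> (forall c, c \in U -> injective c) ->
  exists g : {ffun 'I_n -> 'I_t},
    (#|U| <= t ^ t * #|[set c in U | [forall i, g (c i) == i]]%SET|)%N.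
Proof.
(* If every [g] failed, summing over all [g] and counting the pairs [(g, c)] the other way round
   would give [t ^ n * #|U| + t ^ n <= t ^ n * #|U|]. *)
move=> t0 Ui; apply: contrapT => /forallNP H.
have : (\sum_(g : {ffun 'I_n -> 'I_t}) (t ^ t *
    #|[set c in U | [forall i, g (c i) == i]]%SET|).+1 <=
    \sum_(g : {ffun 'I_n -> 'I_t}) #|U|)%N.
  by apply: leq_sum => g _; rewrite ltnNge; apply/negP; exact: H.
apply/negP; rewrite -ltnNge.
under [X in (_ < X)%N]eq_bigr do rewrite -addn1.
rewrite big_split/= -big_distrr/= sum_nat_const mulnC.
have -> : (\sum_(g : {ffun 'I_n -> 'I_t})
     #|[set c in U | [forall i, g (c i) == i]]%SET| =
   \sum_(c in U) #|[set g : {ffun 'I_n -> 'I_t} | [forall i, g (c i) == i]]%SET|)%N.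
  transitivity (\sum_(c in U) \sum_(g : {ffun 'I_n -> 'I_t} | [forall i, g (c i) == i]) 1)%N; last first.
    by apply: eq_bigr => c _; rewrite sum1dep_card.
  transitivity (\sum_(g : {ffun 'I_n -> 'I_t}) \sum_(c in U | [forall i, g (c i) == i]) 1)%N.
    by apply: eq_bigr => g _; rewrite sum1dep_card.
  rewrite (exchange_big_dep (mem U))/=; last by move=> g c _ /andP[].
  by apply: eq_bigr => c cU; apply: eq_bigl => g; rewrite cU.
rewrite big_distrr/=.
rewrite (eq_bigr (fun=> t ^ n)%N) => [|c cU]; last exact/card_ffun_extending/Ui.
rewrite sum_nat_const card_ffun !card_ord -[X in (X < _)%N]addn0 ltn_add2l.
by rewrite sum_nat_const muln1 card_ffun !card_ord expn_gt0 t0.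
Qed.

(** Rows are chosen greedily: each new one catches at least a fraction [t ^- t] of the injective
    tuples that are still uncaught. *)
Lemma exists_good_rows (m n t : nat) : (0 < t)%N ->
  exists2 gs : seq {ffun 'I_n -> 'I_t}, size gs = m &
    ((t ^ t) ^ m * #|[set c : {ffun 'I_t -> 'I_n} | injectiveb c &&
       all (fun g : {ffun 'I_n -> 'I_t} => ~~ [forall i, g (c i) == i]) gs]%SET|
     <= (t ^ t - 1) ^ m * n ^ t)%N.
Proof.
move=> t0; elim: m => [|m [gs sg IH]].
  exists [::] => //; rewrite !expn0 !mul1n.
  by apply: leq_trans (max_card _) _; rewrite card_ffun !card_ord.
set U := [set c | _]%SET in IH.
have [|g hg] := @exists_good_row n t U t0.
  by move=> c; rewrite inE => /andP[/injectiveP].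
exists (g :: gs); first by rewrite /= sg.
set U' := [set c | _]%SET.
have E : (#|U| = #|U'| + #|[set c in U | [forall i, g (c i) == i]]%SET|)%N.
  rewrite -(cardsID [set c : {ffun 'I_t -> 'I_n} | [forall i, g (c i) == i]]%SET U) addnC.
  congr (_ + _)%N; apply: eq_card => c; rewrite !inE//=.
  by case: [forall i, _]; case: injectiveb; case: all.
have T0 : (0 < t ^ t)%N by rewrite expn_gt0 t0.
have h : (t ^ t * #|U'| <= (t ^ t - 1) * #|U|)%N.
  rewrite mulnBl mul1n; move: hg; rewrite E; set V := #|_| => hg.
  by rewrite mulnDr -addnBA// leq_addr.
rewrite !expnS -mulnA mulnCA.
apply: (leq_trans (n := (t ^ t) ^ m * ((t ^ t - 1) * #|U|))).
  by rewrite leq_mul2l h orbT.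
by rewrite mulnCA -mulnA leq_mul2l IH orbT.
Qed.

Lemma exists_SHF_ones (m n t : nat) : (0 < t)%N ->
  ((t ^ t - 1) ^ m * n ^ t < (t ^ t) ^ m)%N ->
  exists A : 'M['I_t]_(m, n), is_SHF (fun _ : 'I_t => 1%N) A.
Proof.
move=> t0 lt; have [gs sg le] := exists_good_rows m n t0.
have := leq_ltn_trans le lt.
rewrite -[X in (_ < X)%N]muln1 ltn_mul2l => /andP[_].
rewrite ltnS leqn0 cards_eq0 => /eqP U0.
pose g0 : {ffun 'I_n -> 'I_t} := [ffun=> Ordinal t0].
exists (\matrix_(r, y) nth g0 gs r y); apply: SHF_ones_of_injective => c ci.
have : finfun c \notin finset.set0 by rewrite inE.
rewrite -U0 inE negb_and.
have -> /= : injectiveb (finfun c) by apply/injectiveP => i i'; rewrite !ffunE => /ci.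
move=> /allPn[g /(nthP g0)[k hk <-]]; rewrite negbK => /forallP gP.
rewrite sg in hk; exists (Ordinal hk) => i i'; rewrite !mxE /=.
by have /eqP := gP i; have /eqP := gP i'; rewrite !ffunE => -> ->.
Qed.

(** * Permutation sums over the simplex *)

(** For [i <= t] this is [i! (t - i)!] times the elementary symmetric polynomial of degree [i]; the
    inequalities below are of Maclaurin type. *)
Definition perm_sum (R : realType) (t : nat) (q : 'I_t -> R) (i : nat) : R :=
  \sum_(s : 'S_t) \prod_(l < t | (l < i)%N) q (s l).

Lemma perm_sum_coord (R : realType) (t : nat) (f : 'I_t -> R) (l : 'I_t) :
  t%:R * \sum_(s : 'S_t) f (s l) = t`!%:R * \sum_a f a.
Proof.
have E k : \sum_(s : 'S_t) f (s k) = \sum_(s : 'S_t) f (s l).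
  rewrite [RHS](reindex_inj (mulgI (tperm l k))).
  by apply: eq_bigr => s _; rewrite permM tpermL.
transitivity (\sum_(k < t) \sum_(s : 'S_t) f (s k)).
  by rewrite (eq_bigr _ (fun k _ => E k)) sumr_const card_ord mulr_natl.
rewrite exchange_big/= (eq_bigr (fun=> \sum_a f a)).
  by rewrite sumr_const card_Sn mulr_natl.
by move=> s _; rewrite [RHS](reindex_inj (@perm_inj _ s)).
Qed.

Section PermSum.
Variables (R : realType) (t : nat) (q : 'I_t -> R).
Hypotheses (q0 : forall a, 0 <= q a) (q1 : \sum_a q a = 1).

(** As the extra factors [q (s k)] sum to 1 over [k], these are [t] pieces of [perm_sum q i]. For
    [i < t] each is at least [perm_sum q i.+1]: the factor is a fresh one if [k >= i] and makes a
    square if [k < i]. *)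
Let T (i : nat) (k : 'I_t) : R :=
  \sum_(s : 'S_t) q (s k) * \prod_(l < t | (l < i)%N) q (s l).

Let T_sum i : \sum_k T i k = perm_sum q i.
Proof.
rewrite /T exchange_big/=; apply: eq_bigr => s _.
rewrite -big_distrl/= [X in X * _](_ : _ = 1) ?mul1r//.
by rewrite -q1 [RHS](reindex_inj (@perm_inj _ s)).
Qed.

Let T_ge i (k : 'I_t) : (i <= k)%N -> T i k = perm_sum q i.+1.
Proof.
move=> ik; have it : (i < t)%N by apply: leq_ltn_trans ik (ltn_ord k).
rewrite /T (reindex_inj (mulgI (tperm (Ordinal it) k))); apply: eq_bigr => s _.
rewrite [RHS](bigD1 (Ordinal it))//= permM tpermR; congr (_ * _).
apply: eq_big => l; first by rewrite ltnS leq_eqVlt -val_eqE/=; lia.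
move=> li; rewrite permM tpermD// -val_eqE/=; lia.
Qed.

(* Swap the values of [s] at [k] and [i], and use AM-GM. *)
Let T_lt i (k : 'I_t) : (i < t)%N -> (k < i)%N -> perm_sum q i.+1 <= T i k.
Proof.
move=> it ki; pose o := Ordinal it.
pose P (s : 'S_t) := \prod_(l < t | (l < i)%N && (l != k)) q (s l).
have P0 s : 0 <= P s by apply: prodr_ge0.
have E1 : T i k = \sum_(s : 'S_t) q (s k) ^+ 2 * P s.
  by apply: eq_bigr => s _; rewrite (bigD1 k)//= mulrA -expr2.
have E2 : T i k = \sum_(s : 'S_t) q (s o) ^+ 2 * P s.
  rewrite E1 (reindex_inj (mulgI (tperm k o))); apply: eq_bigr => s _.
  rewrite permM tpermL; congr (_ * _).
  apply: eq_bigr => l /andP[li lk]; rewrite permM tpermD//; first by rewrite eq_sym.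
  by rewrite -val_eqE/=; lia.
have E3 : perm_sum q i.+1 = \sum_(s : 'S_t) q (s k) * q (s o) * P s.
  apply: eq_bigr => s _; rewrite (bigD1 k)/=; last by lia.
  rewrite (bigD1 o)/=; last by rewrite -val_eqE/=; lia.
  rewrite mulrA; congr (_ * _); apply: eq_bigl => l; rewrite -!val_eqE/=; lia.
suff : 2 * perm_sum q i.+1 <= T i k + T i k by lra.
rewrite {1}E1 E2 E3 -big_split mulr_sumr; apply: ler_sum => s _ /=.
rewrite -mulrDl mulrA ler_wpM2r//.
by have := sqr_ge0 (q (s k) - q (s o)); rewrite sqrrB; lra.
Qed.

Lemma perm_sumS i : (i < t)%N -> t%:R * perm_sum q i.+1 <= perm_sum q i.
Proof.
move=> it; rewrite -[X in _ <= X]T_sum.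
rewrite -[X in X%:R](card_ord t) mulr_natl -sumr_const; apply: ler_sum => k _.
by have [/T_ge->//|] := leqP i k; exact: T_lt.
Qed.

Lemma perm_sum0 : perm_sum q 0 = t`!%:R.
Proof.
rewrite /perm_sum (eq_bigr (fun=> 1)) => [|s _]; last by rewrite big1.
by rewrite sumr_const card_Sn.
Qed.

Lemma perm_sum_le i : (i <= t)%N -> t%:R ^+ i * perm_sum q i <= t`!%:R.
Proof.
elim: i => [|i IH] it; first by rewrite expr0 mul1r perm_sum0.
apply: le_trans (IH (ltnW it)).
by rewrite exprSr -mulrA ler_wpM2l ?exprn_ge0// perm_sumS.
Qed.

(** The gain comes from degree 2 alone, where the sum of squares determines [perm_sum q 2] exactly;
    higher degrees follow by [perm_sumS]. *)
Lemma perm_sum_le_var i : (2 <= i)%N -> (i <= t)%N ->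
  t%:R ^+ i * perm_sum q i <= t`!%:R * (1 - \sum_a (q a - t%:R^-1) ^+ 2).
Proof.
elim: i => // i IH; rewrite leq_eqVlt => /orP[/eqP[<-]|i2] it; last first.
  apply: le_trans (IH i2 (ltnW it)).
  by rewrite exprSr -mulrA ler_wpM2l ?exprn_ge0// perm_sumS.
have t0 : 0 < t%:R :> R by rewrite ltr0n; lia.
have t1 : 1 < t%:R :> R by rewrite ltr1n.
have t1' : (1 < t)%N by [].
pose o := Ordinal (ltnW t1').
set D := \sum_a _.
have DE : D = \sum_a q a ^+ 2 - t%:R^-1.
  transitivity (\sum_a (q a ^+ 2 + - (2 / t%:R) * q a + t%:R^-1 ^+ 2)).
    by apply: eq_bigr => a _; ring.
  rewrite !big_split/= -mulr_sumr q1 sumr_const card_ord -[_ *+ t]mulr_natl.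
  by field; rewrite gt_eqF.
have D0 : 0 <= D by apply: sumr_ge0 => a _; rewrite sqr_ge0.
have H1 : t%:R * perm_sum q 1 = t`!%:R.
  transitivity (t%:R * \sum_(s : 'S_t) q (s o)).
    congr (_ * _); apply: eq_bigr => s _; rewrite (bigD1 o)//= big1 ?mulr1// => l.
    by rewrite -val_eqE/=; lia.
  by rewrite perm_sum_coord q1 mulr1.
have H2 : t%:R * T 1 o = t`!%:R * (D + t%:R^-1).
  rewrite DE subrK -(perm_sum_coord (fun a => q a ^+ 2) o); congr (_ * _).
  apply: eq_bigr => s _; rewrite (bigD1 o)//= big1 ?mulr1// => l.
  by rewrite -val_eqE/=; lia.
have H3 : perm_sum q 1 = T 1 o + (t%:R - 1) * perm_sum q 2.
  rewrite -T_sum (bigD1 o)//=; congr (_ + _).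
  rewrite (eq_bigr (fun=> perm_sum q 2)) => [|k]; last first.
    by rewrite -val_eqE/= => k0; apply: T_ge; lia.
  rewrite sumr_const -[LHS]mulr_natl; congr (_ * _).
  rewrite -(natrB _ (ltnW t1')); congr (_%:R).
  by rewrite (cardC1 o) card_ord; lia.
have H4 : t`!%:R * (1 - t%:R^-1 - D) = (t%:R - 1) * (t%:R * perm_sum q 2).
  by have := H1; rewrite H3 mulrDr H2; lra.
(* The exact loss carries the factor [t / (t - 1) >= 1], which is then dropped. *)
have -> : t%:R ^+ 2 * perm_sum q 2 = t`!%:R * (1 - t%:R / (t%:R - 1) * D).
  have : t%:R * perm_sum q 2 = t`!%:R * (1 - t%:R^-1 - D) / (t%:R - 1).
    by rewrite H4; field; rewrite subr_eq0 gt_eqF.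
  rewrite (_ : t%:R ^+ 2 * _ = t%:R * (t%:R * perm_sum q 2)); last by ring.
  move=> ->; field; rewrite ?gt_eqF//; lra.
by rewrite ler_wpM2l// lerD2l lerN2 ler_peMl// ler_pdivlMr; lra.
Qed.

End PermSum.

(** * Upper bounds for type {1, ..., 1} *)

(* In each row delete the lightest colour: a vertex active in the row loses on
   average a fraction [k^-1] of its weight, and the row stops being rainbow. *)
Lemma weighted_rainbow_cover (R : realType) (V T : finType) (I : eqType) (k : nat)
    (act : I -> {set V}) (col : I -> V -> T) (K : I -> {set T})
    (rs : seq I) (Y0 : {set V}) :
  (0 < k)%N ->
  (forall r v, v \in act r -> (col r v \in K r) && (#|K r| == k)) ->
  (forall Y : {set V}, Y \subset Y0 -> #|Y| = k ->
     exists r, [/\ r \in rs, Y \subset act r & {in Y &, injective (col r)}]) ->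
  \sum_(v in Y0) (1 - k%:R^-1) ^+ count (fun r => v \in act r) rs
    <= (k%:R - 1 : R).
Proof.
move=> k0 hK; elim: rs Y0 => [|r rs IH] Y0 cov.
  (* Without rows no [k]-subset of [Y0] can be covered, so [Y0] has at most [k - 1] elements. *)
  under eq_bigr do rewrite expr0; rewrite sumr_const.
  rewrite lerBrDr -mulrSr ler_nat ltnNge; apply/negP => /card_geqP[s [us ss sY]].
  have [||r []] // := cov [set x in s]%SET.
    by apply/fintype.subsetP => x; rewrite inE => /sY.
  by rewrite cardsE (card_uniqP us).
pose b : R := 1 - k%:R^-1.
pose om v := b ^+ count (fun r => v \in act r) rs.
have kp : 0 < k%:R :> R by rewrite ltr0n.
have b0 : 0 <= b by rewrite subr_ge0 invf_le1// ler1n.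
have om0 v : 0 <= om v by rewrite exprn_ge0.
have E : \sum_(v in Y0) b ^+ count (fun r => v \in act r) (r :: rs) =
    \sum_(v in Y0) om v - k%:R^-1 * \sum_(v in Y0 | v \in act r) om v.
  rewrite big_mkcondr/= mulr_sumr -sumrB; apply: eq_bigr => v _ /=.
  rewrite exprD -/(om v); case: (v \in act r); rewrite ?expr1 ?expr0 /b; ring.
rewrite -/b E.
pose W a := \sum_(v in Y0 | (v \in act r) && (col r v == a)) om v.
have [v0 v0Y|none] := pickP [pred v in Y0 | v \in act r]; last first.
  rewrite [X in _ * X]big_pred0 ?mulr0 ?subr0//; apply: IH => Y YY cY.
  have [r' [+ Ya Yi]] := cov Y YY cY; rewrite inE => /predU1P[e|r's]; last by exists r'.
  have /card_gt0P[v vY] : (0 < #|Y|)%N by rewrite cY.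
  have := none v; rewrite /= (fintype.subsetP YY)//= -e.
  by rewrite (fintype.subsetP Ya).
have /andP[_ v0a] := v0Y.
have /andP[_ /eqP cK] := hK _ _ v0a.
(* Some colour of [K r] carries at most the average weight of the [k] colours. *)
have [a aK aW] : exists2 a, a \in K r &
    k%:R * W a <= \sum_(v in Y0 | v \in act r) om v.
  apply: contrapT => H.
  have lt : \sum_(a in K r) \sum_(v in Y0 | v \in act r) om v
      < \sum_(a in K r) k%:R * W a.
    apply: ltr_sum => [|a aK].
      have /andP[cv _] := hK _ _ v0a.
      by apply/hasP; exists (col r v0) => //; rewrite mem_index_enum.
    by rewrite ltNge; apply/negP => h; apply: H; exists a.
  move: lt; rewrite sumr_const cK -mulr_sumr -[X in X < _]mulr_natl ltr_pM2l// ltNge.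
  move/negP; apply; rewrite le_eqVlt; apply/orP; left; apply/eqP.
  rewrite (partition_big (col r) (mem (K r)))/=; last first.
    by move=> v /andP[_ /hK/andP[]].
  by apply: eq_bigr => c _; apply: eq_bigl => v; rewrite andbA.
(* Once the active vertices of colour [a] are deleted, the row shows at most [k - 1] colours, so no
   [k]-subset of [Y1] is rainbow in it. The deleted weight is at most what the factor [1 - 1/k]
   takes away. *)
pose Y1 := [set v in Y0 | ~~ ((v \in act r) && (col r v == a))]%SET.
have Y1Y0 : Y1 \subset Y0 by apply/fintype.subsetP => v; rewrite inE => /andP[].
have le1 : \sum_(v in Y1) om v <= k%:R - 1.
  apply: IH => Y YY cY.
  have [r' [+ Ya Yi]] := cov Y (fintype.subset_trans YY Y1Y0) cY.
  rewrite inE => /predU1P[e|r's]; last by exists r'.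
  move: Ya Yi; rewrite e => Ya Yi.
  have : #|col r @: Y| = k by rewrite card_in_imset.
  have : col r @: Y \subset (K r :\ a)%SET.
    apply/fintype.subsetP => _ /imsetP[v vY ->]; rewrite in_setD1.
    have vA := fintype.subsetP Ya v vY; have /andP[-> _] := hK _ _ vA.
    have := fintype.subsetP YY v vY; rewrite inE vA/= => /andP[_ ->].
    by [].
  move/subset_leq_card => + c; rewrite c.
  by have := cardsD1 a (K r); rewrite aK cK; lia.
apply: le_trans le1.
have -> : \sum_(v in Y0) om v = W a + \sum_(v in Y1) om v.
  rewrite (bigID (fun v => (v \in act r) && (col r v == a)))/=; congr (_ + _).
  by apply: eq_bigl => v; rewrite inE.
rewrite -addrA [W a + _]addrC -addrA gerDl addrC subr_le0.
by rewrite mulrC ler_pdivlMr// mulrC.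
Qed.

(** * Counting rainbow tuples *)

(** Composing one permutation [p0] that starts with [s] with those fixing the first [size s]
    positions gives [(t - size s)!] solutions. *)
Lemma card_perm_extending (t : nat) (a0 : 'I_t) (s : seq 'I_t) : uniq s ->
  ((t - size s)`! <=
   #|[set p : 'S_t | [forall l : 'I_t, (l < size s)%N ==> (p l == nth a0 s l)]]%SET|)%N.
Proof.
move=> us.
pose s' := s ++ enum [predC s].
have us' : uniq s'.
  rewrite cat_uniq us enum_uniq andbT /=.
  by apply/hasPn => x; rewrite mem_enum.
have ss' : size s' = t.
  rewrite size_cat -cardE -[RHS]card_ord -(cardC (mem s)).
  by rewrite (card_uniqP us).
have fi : injective (fun l : 'I_t => nth a0 s' l).
  by move=> l l' /eqP; rewrite nth_uniq ?ss'// => /eqP/val_inj.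
pose p0 := perm fi.
pose L := [set l : 'I_t | (size s <= l)%N]%SET.
have cL : #|L| = (t - size s)%N.
  rewrite /L -sum1dep_card; rewrite -(big_geq_mkord _ _ xpredT (fun=> 1%N))/=.
  by rewrite sum_nat_const_nat muln1.
rewrite -cL -card_perm -(card_imset _ (@mulIg _ p0)); apply: subset_leq_card.
apply/fintype.subsetP => _ /imsetP[u + ->]; rewrite inE => uL.
apply/forallP => l; apply/implyP => ls.
rewrite permM (out_perm uL) ?inE -?ltnNge// permE.
by rewrite nth_cat ls.
Qed.

Lemma nth_codom_ord (T : Type) (j : nat) (x : 'I_j -> T) (x0 : T) (l : 'I_j) :
  nth x0 (codom x) l = x l.
Proof. by rewrite codomE (nth_map l) ?size_enum_ord// nth_ord_enum. Qed.

Definition rainbow (n t j : nat) (f : 'I_n -> 'I_t) (x : {ffun 'I_j -> 'I_n})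
    (v : 'I_n) : bool :=
  uniq [seq f y | y <- rcons (codom x) v].

(** A rainbow pair [(x, v)] prescribes the first [j.+1] values of a permutation, which leaves at
    least [(t - j.+1)!] of them; for a fixed permutation the number of pairs is a product of colour
    class sizes. *)
Lemma rainbow_count_le (n t j : nat) (hj : (j < t)%N) (f : 'I_n -> 'I_t)
    (S : {set 'I_n}) :
  ((t - j.+1)`! * \sum_(x : {ffun 'I_j -> 'I_n} | x \in ffun_on (mem S))
      #|[set v | rainbow f x v]%SET| <=
   \sum_(p : 'S_t) (\prod_(l < t | (l < j)%N) #|[set y in S | f y == p l]%SET|) *
      #|[set v | f v == p (Ordinal hj)]%SET|)%N.
Proof.
pose P (x : {ffun 'I_j -> 'I_n}) (v : 'I_n) (p : 'S_t) :=
  [forall l : 'I_j, f (x l) == p (widen_ord (ltnW hj) l)] && (f v == p (Ordinal hj)).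
have le1 x v : ((t - j.+1)`! * rainbow f x v <= #|[set p | P x v p]%SET|)%N.
  case r : (rainbow f x v); last by rewrite muln0.
  have sz : size [seq f y | y <- rcons (codom x) v] = j.+1.
    by rewrite size_map size_rcons size_codom card_ord.
  rewrite muln1 -[X in (t - X)%N]sz.
  apply: leq_trans (card_perm_extending (Ordinal hj) r) _.
  apply: subset_leq_card; apply/fintype.subsetP => p; rewrite !inE sz => /forallP H.
  apply/andP; split; last first.
    have := H (Ordinal hj); rewrite /= ltnSn map_rcons nth_rcons size_map size_codom.
    by rewrite card_ord ltnn eqxx => /eqP ->.
  apply/forallP => l; have := H (widen_ord (ltnW hj) l).
  rewrite /= ltnS (ltnW (ltn_ord l)) map_rcons nth_rcons size_map size_codom.
  rewrite card_ord ltn_ord (nth_map v) ?size_codom ?card_ord//.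
  by rewrite nth_codom_ord => /eqP ->.
rewrite big_distrr/=.
apply: (leq_trans (n := \sum_(x : {ffun 'I_j -> 'I_n} | x \in ffun_on (mem S))
   \sum_(v : 'I_n) \sum_(p : 'S_t) P x v p)).
  apply: leq_sum => x _; rewrite -sum1dep_card big_mkcond big_distrr/=.
  apply: leq_sum => v _; apply: leq_trans (le1 x v) _.
  by rewrite -sum1dep_card big_mkcond.
under eq_bigr do rewrite exchange_big.
rewrite exchange_big/=; apply: leq_sum => p _.
rewrite (eq_bigr (fun x : {ffun 'I_j -> 'I_n} =>
    [forall l, f (x l) == p (widen_ord (ltnW hj) l)] *
    #|[set v | f v == p (Ordinal hj)]%SET|))%N; last first.
  move=> x _; rewrite /P -sum1dep_card [X in (_ * X)%N]big_mkcond/= big_distrr/=.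
  by apply: eq_bigr => v _; case: [forall l, _]; case: (f v == _).
rewrite -big_distrl/= leq_mul2r; apply/orP; right.
rewrite (big_ord_narrow (ltnW hj)).
have := card_family (fun l : 'I_j =>
  [pred y | (y \in S) && (f y == p (widen_ord (ltnW hj) l))]).
rewrite foldrE big_map big_enum/= => cf.
rewrite (eq_bigr (fun l : 'I_j => #|[pred y | (y \in S) && (f y == p (widen_ord (ltnW hj) l))]|)); last first.
  by move=> l _; rewrite cardsE.
rewrite -cf -big_mkcondr/= sum1dep_card; apply: eq_leq.
apply: eq_card => x; rewrite inE.
apply/andP/familyP => [[/ffun_onP xS /forallP H] l|H]; first by rewrite inE /= xS H.
split; first by apply/ffun_onP => l; have := H l; rewrite inE => /andP[].
by apply/forallP => l; have := H l; rewrite inE => /andP[].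
Qed.

(* Equal to [0] if [S] is empty. *)
Definition freq (R : realType) (n t : nat) (S : {set 'I_n}) (f : 'I_n -> 'I_t)
    (a : 'I_t) : R :=
  #|[set y in S | f y == a]%SET|%:R / #|S|%:R.

Lemma freq_ge0 (R : realType) (n t : nat) (S : {set 'I_n}) (f : 'I_n -> 'I_t) a :
  0 <= freq R S f a.
Proof. by rewrite divr_ge0. Qed.

Lemma freq_sum (R : realType) (n t : nat) (S : {set 'I_n}) (f : 'I_n -> 'I_t) :
  (0 < #|S|)%N -> \sum_a freq R S f a = 1.
Proof.
move=> S0; rewrite -mulr_suml -natr_sum.
rewrite (_ : (\sum_a _)%N = #|S|) ?divff ?pnatr_eq0 -?lt0n//.
rewrite -sum1_card (partition_big f xpredT)//=; apply: eq_bigr => a _.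
by rewrite sum1dep_card.
Qed.

Lemma freq_natr (R : realType) (n t : nat) (S : {set 'I_n}) (f : 'I_n -> 'I_t) a :
  (0 < #|S|)%N ->
  #|[set y in S | f y == a]%SET|%:R = #|S|%:R * freq R S f a.
Proof. by move=> S0; rewrite /freq mulrC divfK// pnatr_eq0 -lt0n. Qed.

Lemma rainbow_sum_le (R : realType) (n t j : nat) (hj : (j < t)%N)
    (f : 'I_n -> 'I_t) (S : {set 'I_n}) :
  (0 < #|S|)%N ->
  (t - j.+1)`!%:R * (\sum_(x : {ffun 'I_j -> 'I_n} | x \in ffun_on (mem S))
      #|[set v | rainbow f x v]%SET|)%:R <=
   #|S|%:R ^+ j * n%:R * (\sum_(p : 'S_t)
     (\prod_(l < t | (l < j)%N) freq R S f (p l)) *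
      freq R [set: 'I_n]%SET f (p (Ordinal hj)) : R).
Proof.
move=> S0.
have cV : #|[set: 'I_n]%SET| = n by rewrite cardsT card_ord.
have V0 : (0 < #|[set: 'I_n]%SET|)%N.
  by apply: leq_trans S0 (subset_leq_card (finset.subsetT _)).
have := rainbow_count_le hj f S; rewrite -(ler_nat R) natrM => /le_trans; apply.
rewrite natr_sum mulr_sumr; apply: ler_sum => p _.
rewrite natrM natr_prod.
rewrite (eq_bigr (fun l : 'I_t => #|S|%:R * freq R S f (p l))); last first.
  by move=> l _; rewrite freq_natr.
rewrite big_split/= (_ : \prod_(l < t | (l < j)%N) #|S|%:R = #|S|%:R ^+ j); last first.
  by rewrite (big_ord_narrow (ltnW hj)) prodr_const card_ord.
rewrite (_ : #|[set v | f v == _]%SET|%:R = n%:R * freq R [set: 'I_n]%SET f (p (Ordinal hj))).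
  by rewrite le_eqVlt; apply/orP; left; apply/eqP; ring.
rewrite -[X in X%:R * _]cV -freq_natr//; congr (_%:R); apply: eq_card => v.
by rewrite !inE.
Qed.

Definition rainbow_rows (m n t j : nat) (A : 'M['I_t]_(m, n))
    (x : {ffun 'I_j -> 'I_n}) (v : 'I_n) : nat :=
  (\sum_(r < m) rainbow (A r) x v)%N.

Lemma rainbow_rows_sum_le (R : realType) (m n t j : nat) (A : 'M['I_t]_(m, n))
    (x : {ffun 'I_j -> 'I_n}) :
  (j < t)%N -> is_SHF (fun _ : 'I_t => 1%N) A -> injective x ->
  \sum_(v | v \notin codom x) (1 - (t - j)%:R^-1) ^+ rainbow_rows A x v
    <= ((t - j)%:R - 1 : R).
Proof.
move=> jt SA xi; have t0 : (0 < t)%N by apply: leq_ltn_trans jt.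
pose act (r : 'I_m) := [set v | rainbow (A r) x v]%SET.
pose K (r : 'I_m) := [set a | a \notin [seq A r y | y <- codom x]]%SET.
have := @weighted_rainbow_cover R _ _ _ (t - j) act (fun r v => A r v) K
  (enum 'I_m) [set v | v \notin codom x]%SET.
rewrite subn_gt0 => /(_ jt) H.
apply: le_trans (H _ _); last 2 first.
- move=> r v; rewrite inE /rainbow map_rcons rcons_uniq inE => /andP[-> u] /=.
  have -> : K r = ~: [set a in [seq A r y | y <- codom x]]%SET.
    by apply/setP => a; rewrite !inE.
  by rewrite cardsCs finset.setCK cardsE (card_uniqP u) size_map size_codom !card_ord.
- move=> Y YX cY.
  have us : uniq (codom x ++ enum Y).
    rewrite cat_uniq enum_uniq andbT; apply/andP; split.
      by rewrite /codom /image_mem map_inj_uniq ?enum_uniq.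
    apply/hasPn => y; rewrite mem_enum => yY.
    by have := fintype.subsetP YX y yY; rewrite inE.
  have ss : size (codom x ++ enum Y) = t.
    by rewrite size_cat size_codom card_ord -cardE cY subnKC// ltnW.
  have [r] := uniq_row_of_SHF_ones t0 SA us ss.
  rewrite map_cat cat_uniq => /and3P[u1 /hasPn u2 u3].
  exists r; rewrite mem_enum; split=> //; last first.
    exact/dinjectiveP.
  apply/fintype.subsetP => y yY.
  rewrite inE /rainbow map_rcons rcons_uniq u1 andbT.
  by apply: u2; apply: map_f; rewrite mem_enum.
rewrite big_mkcond [leRHS]big_mkcond/=; apply: ler_sum => v _.
rewrite inE; case: ifP => // _; rewrite le_eqVlt; apply/orP; left; apply/eqP.
congr (_ ^+ _); rewrite -sum1_count big_enum_cond big_mkcond/=.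
by apply: eq_bigr => r _; rewrite inE; case: rainbow.
Qed.

(** Replacing the convex function [expR (- la * d)] by its tangent at [d = mu] makes the preceding
    bound linear in [d = rainbow_rows A x v], so that after summing over injective [x] only the
    total of [d] matters. *)
Lemma rainbow_rows_tangent (R : realType) (m n t j : nat) (A : 'M['I_t]_(m, n))
    (S : {set 'I_n}) (mu la : R) :
  (j.+1 < t)%N -> is_SHF (fun _ : 'I_t => 1%N) A ->
  la = ln ((t - j)%:R / ((t - j)%:R - 1)) -> 
  (#|S| ^_ j)%:R * (n - j)%:R * (1 + la * mu) - la *
     (\sum_(x : {ffun 'I_j -> 'I_n} | x \in ffun_on (mem S))
        \sum_v rainbow_rows A x v)%:R
  <= (#|S| ^_ j)%:R * (((t - j)%:R - 1) * expR (la * mu)).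
Proof.
move=> jt SA laE.
have k1 : 1 < (t - j)%:R :> R by rewrite ltr1n; lia.
have la0 : 0 <= la by rewrite laE ln_ge0// ler_pdivlMr; lra.
have bE : 1 - (t - j)%:R^-1 = expR (- la) :> R.
  have kk0 : 0 < (t - j)%:R / ((t - j)%:R - 1) :> R by rewrite divr_gt0//; lra.
  rewrite laE expRN lnK ?posrE//; field.
  by apply/andP; split; apply/eqP; lra.
pose Q (x : {ffun 'I_j -> 'I_n}) := (x \in ffun_on (mem S)) && injectiveb x.
have cQ : (#|S| ^_ j)%:R = \sum_(x | Q x) (1 : R).
  rewrite sumr_const; congr (_%:R).
  have := card_inj_ffuns_on 'I_j (mem S); rewrite card_ord => <-.
  by apply: eq_card => x; rewrite inE.
have cX x : Q x -> \sum_(v | v \notin codom x) (1 : R) = (n - j)%:R.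
  move=> /andP[_ /injectiveP xi]; rewrite sumr_const; congr (_%:R).
  have := cardC (mem (codom x)); rewrite card_codom// !card_ord => e.
  by rewrite -[X in (X - _)%N]e addKn.
have hx x : Q x -> \sum_(v | v \notin codom x)
     (1 + la * mu - la * (rainbow_rows A x v)%:R) <= ((t - j)%:R - 1) * expR (la * mu).
  move=> /andP[_ /injectiveP xi].
  have := rainbow_rows_sum_le R (ltnW jt) SA xi.
  rewrite bE -(ler_pM2r (expR_gt0 (la * mu))) => /(le_trans _); apply.
  rewrite mulr_suml; apply: ler_sum => v _.
  rewrite -expRM_natl -expRD; apply: le_trans (expR_ge1Dx _).
  by rewrite le_eqVlt; apply/orP; left; apply/eqP; ring.
rewrite [leRHS](_ : _ = \sum_(x | Q x) (((t - j)%:R - 1) * expR (la * mu))); last first.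
  by rewrite cQ mulr_suml; apply: eq_bigr => x _; rewrite mul1r.
apply: le_trans (ler_sum _ hx).
rewrite (eq_bigr (fun x : {ffun 'I_j -> 'I_n} => (n - j)%:R * (1 + la * mu) - la *
     \sum_(v | v \notin codom x) (rainbow_rows A x v)%:R)); last first.
  move=> x Qx; rewrite sumrB -mulr_sumr -(cX x Qx) mulr_suml.
  by congr (_ - _); apply: eq_bigr => v _; rewrite mul1r.
rewrite sumrB -[X in _ <= _ - X]mulr_sumr; apply: lerB.
  by rewrite cQ -mulrA mulr_suml; apply: ler_sum => x _; rewrite mul1r.
apply: ler_wpM2l => //.
rewrite natr_sum (big_mkcond Q) (big_mkcond (fun x => x \in ffun_on (mem S)))/=.
apply: ler_sum => x _; rewrite /Q; case: (x \in _) => //=.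
rewrite natr_sum; case: injectiveb; last by apply: sumr_ge0.
by rewrite [leLHS]big_mkcond; apply: ler_sum => v _; case: ifP.
Qed.

Lemma gfracE (R : realType) (t k : nat) : (k <= t)%N ->
  (t - k)`!%:R * gfrac R t k = t`!%:R / t%:R ^+ k.
Proof. by move=> kt; rewrite /gfrac mulrA -natrM mulnC ffact_fact. Qed.

Lemma gfrac_gt0 (R : realType) (t k : nat) : (0 < t)%N -> (k <= t)%N ->
  0 < gfrac R t k.
Proof. by move=> t0 kt; rewrite divr_gt0 ?exprn_gt0 ?ltr0n ?ffact_gt0. Qed.

Definition freq_var (R : realType) (n t : nat) (f : 'I_n -> 'I_t) : R :=
  \sum_a (freq R [set: 'I_n]%SET f a - t%:R^-1) ^+ 2.

(** Here [x] and [v] range over the same columns, so the frequencies combine to [perm_sum] in degree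
    [j.+1 >= 2], where the variance is gained. *)
Lemma rainbow_sum_le_var (R : realType) (n t j : nat) (f : 'I_n -> 'I_t) :
  (0 < n)%N -> (0 < j)%N -> (j < t)%N ->
  (\sum_(x : {ffun 'I_j -> 'I_n} | x \in ffun_on (mem [set: 'I_n]%SET))
      #|[set v | rainbow f x v]%SET|)%:R <=
   n%:R ^+ j * n%:R * gfrac R t j.+1 * (1 - freq_var R f).
Proof.
move=> n0 j0 jt.
have cV : #|[set: 'I_n]%SET| = n by rewrite cardsT card_ord.
have V0 : (0 < #|[set: 'I_n]%SET|)%N by rewrite cV.
have := rainbow_sum_le R jt f V0; rewrite cV => H.
have tj : 0 < t%:R ^+ j.+1 :> R by rewrite exprn_gt0// ltr0n; lia.
have F0 : 0 < (t - j.+1)`!%:R :> R by rewrite ltr0n fact_gt0.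
rewrite -(ler_pM2l F0); apply: le_trans H _.
have -> : (t - j.+1)`!%:R * (n%:R ^+ j * n%:R * gfrac R t j.+1 * (1 - freq_var R f)) =
    n%:R ^+ j * n%:R * ((t - j.+1)`!%:R * gfrac R t j.+1 * (1 - freq_var R f)) by ring.
rewrite gfracE// ler_wpM2l ?mulr_ge0 ?exprn_ge0//.
rewrite mulrAC ler_pdivlMr// mulrC.
have := perm_sum_le_var (@freq_ge0 R n t _ f) (freq_sum R f V0) (_ : (2 <= j.+1)%N) jt.
move=> /(_ j0); apply: le_trans.
rewrite ler_wpM2l ?exprn_ge0//; apply: ler_sum => p _.
rewrite [leRHS](bigD1 (Ordinal jt))//= mulrC le_eqVlt; apply/orP; left; apply/eqP.
by congr (_ * _); apply: eq_bigl => l; rewrite ltnS -val_eqE/=; lia.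
Qed.

(* AM-GM bounds each deviation [d] from [t^-1] by [c * d ^+ 2 + (4 * c)^-1]. *)
Lemma rainbow_sum_le_dev (R : realType) (n t j : nat) (f : 'I_n -> 'I_t)
    (S : {set 'I_n}) (c : R) :
  (0 < #|S|)%N -> (j < t)%N -> 0 < c ->
  (\sum_(x : {ffun 'I_j -> 'I_n} | x \in ffun_on (mem S))
      #|[set v | rainbow f x v]%SET|)%:R <=
   #|S|%:R ^+ j * n%:R * gfrac R t j.+1 * 
     (1 + t%:R * (c * freq_var R f + (4 * c)^-1)).
Proof.
move=> S0 jt c0.
have V0 : (0 < #|[set: 'I_n]%SET|)%N.
  by apply: leq_trans S0 (subset_leq_card (finset.subsetT _)).
have t0 : 0 < t%:R :> R by rewrite ltr0n; lia.
have F0 : 0 < (t - j.+1)`!%:R :> R by rewrite ltr0n fact_gt0.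
rewrite -(ler_pM2l F0); apply: le_trans (rainbow_sum_le R jt f S0) _.
set e := c * _ + _.
have -> : (t - j.+1)`!%:R * (#|S|%:R ^+ j * n%:R * gfrac R t j.+1 * (1 + t%:R * e)) =
    #|S|%:R ^+ j * n%:R * ((t - j.+1)`!%:R * gfrac R t j.+1 * (1 + t%:R * e)) by ring.
rewrite gfracE// ler_wpM2l ?mulr_ge0 ?exprn_ge0//.
have he a : freq R [set: 'I_n]%SET f a <= t%:R^-1 + e.
  rewrite -lerBlDl; set d := _ - _.
  have dD : d ^+ 2 <= freq_var R f.
    by rewrite /freq_var (bigD1 a)//= lerDl sumr_ge0// => b _; rewrite sqr_ge0.
  apply: (le_trans (y := c * d ^+ 2 + (4 * c)^-1)); last first.
    by rewrite lerD2r ler_wpM2l// ltW.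
  rewrite -subr_ge0 (_ : _ - d = c * (d - (2 * c)^-1) ^+ 2).
    by rewrite mulr_ge0 ?sqr_ge0// ltW.
  by field; rewrite gt_eqF.
have e0 : 0 <= e.
  by rewrite addr_ge0 ?mulr_ge0 ?invr_ge0 ?mulr_ge0 ?sumr_ge0 ?ltW// => a _; rewrite sqr_ge0.
(* The colours may be distributed arbitrarily on [S]: [perm_sum_le] bounds the contribution of [x],
   and balance of the row enters only through [v], which ranges over all columns. *)
have hp := perm_sum_le (@freq_ge0 R n t S f) (freq_sum R f S0) (ltnW jt).
apply: (le_trans (y := perm_sum (freq R S f) j * (t%:R^-1 + e))).
  rewrite mulr_suml; apply: ler_sum => p _; apply: ler_wpM2l (he _).
  by apply: prodr_ge0 => l _; exact: freq_ge0.
have -> : t`!%:R / t%:R ^+ j.+1 * (1 + t%:R * e) = t`!%:R / t%:R ^+ j * (t%:R^-1 + e).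
  by rewrite exprS; field; rewrite gt_eqF// expf_neq0// gt_eqF.
rewrite ler_wpM2r//; first by rewrite addr_ge0// invr_ge0 ltW.
by rewrite ler_pdivlMr ?exprn_gt0// mulrC.
Qed.

(** * The bound for [j >= 2] *)

Lemma exists_majority (n t : nat) (f : 'I_n -> 'I_t) : (0 < t)%N ->
  exists a, (n <= t * #|[set y | f y == a]%SET|)%N.
Proof.
move=> t0; apply: contrapT => /forallNP H.
have : (\sum_(a : 'I_t) (t * #|[set y | f y == a]%SET|).+1 <= \sum_(a : 'I_t) n)%N.
  by apply: leq_sum => a _; rewrite ltnNge; apply/negP; exact: H.
apply/negP; rewrite -ltnNge; under [X in (_ < X)%N]eq_bigr do rewrite -addn1.
rewrite big_split/= -big_distrr/= !sum_nat_const !card_ord muln1.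
rewrite (_ : (\sum_a _)%N = n); first lia.
rewrite -[RHS]card_ord -sum1_card (partition_big f xpredT)//=.
by apply: eq_bigr => a _; rewrite sum1dep_card.
Qed.

(* If the rows are far from balanced on average, all columns will do. Otherwise
   take a class of the first row: that row is then lost, at almost no cost in
   the other rows. *)
Lemma exists_biased_set (R : realType) (m n t j : nat) (A : 'M['I_t]_(m, n)) :
  (0 < m)%N -> (0 < n)%N -> (1 < j)%N -> (j < t)%N ->
  exists S : {set 'I_n}, [/\ (n <= t * #|S|)%N, (0 < #|S|)%N &
    (\sum_(x : {ffun 'I_j -> 'I_n} | x \in ffun_on (mem S))
        \sum_v rainbow_rows A x v)%:R <=
     #|S|%:R ^+ j * n%:R * gfrac R t j.+1 * (m%:R - (4 * t%:R ^+ 2 * m%:R)^-1)].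
Proof.
move=> m0 n0 j1 jt.
have mp : 1 <= m%:R :> R by rewrite ler1n.
have tp : 1 <= t%:R :> R by rewrite ler1n; lia.
have G0 : 0 < gfrac R t j.+1 by apply: gfrac_gt0 => //; lia.
set th := (4 * _ * _)^-1.
have t2p : 1 <= t%:R ^+ 2 :> R by rewrite exprn_ege1.
have thE : th * (4 * t%:R ^+ 2 * m%:R) = 1.
  by rewrite /th mulVf// gt_eqF// !mulr_gt0//; lra.
have th0 : 0 < th by rewrite invr_gt0 !mulr_gt0//; lra.
have SE (S : {set 'I_n}) : (\sum_(x : {ffun 'I_j -> 'I_n} | x \in ffun_on (mem S))
        \sum_v rainbow_rows A x v)%:R =
    \sum_(r < m) (\sum_(x : {ffun 'I_j -> 'I_n} | x \in ffun_on (mem S))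
        #|[set v | rainbow (A r) x v]%SET|)%:R :> R.
  rewrite -natr_sum [in RHS]exchange_big/=; congr (_%:R); apply: eq_bigr => x _.
  rewrite exchange_big/=; apply: eq_bigr => r _.
  by rewrite -sum1dep_card [RHS]big_mkcond.
have [hD|hD] := leP th (\sum_(r < m) freq_var R (A r)).
  have cV : #|[set: 'I_n]%SET| = n by rewrite cardsT card_ord.
  exists [set: 'I_n]%SET; rewrite cV; split=> //; first by rewrite leq_pmull//; lia.
  rewrite SE; apply: (le_trans (ler_sum _ (fun r _ => rainbow_sum_le_var R (A r) n0 (ltnW j1) jt))).
  rewrite -mulr_sumr ler_wpM2l ?(mulr_ge0, exprn_ge0, ltW G0)//.
  by rewrite sumrB sumr_const card_ord lerD2l lerN2.
pose r0 := Ordinal m0.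
have [a ha] := exists_majority (A r0) (ltnW (ltn_trans j1 jt)).
set S := [set _ | _]%SET in ha; exists S.
have S0 : (0 < #|S|)%N by rewrite lt0n; apply: contraTneq ha => ->; rewrite muln0 -ltnNge.
(* All columns of [S] agree in row [r0], and [x] has at least two entries because [1 < j]; hence
   this row contributes nothing. *)
split=> //; rewrite SE (bigD1 r0)//= big1 ?add0r; last first.
  move=> x /ffun_onP xS; apply: eq_card0 => v; rewrite inE /rainbow.
  pose i0 := Ordinal (ltnW j1); pose i1 := Ordinal j1.
  rewrite inE; apply/negbTE; rewrite map_rcons rcons_uniq negb_and; apply/orP; right.
  rewrite /codom /image_mem -map_comp; apply/negP => /(@dinjectiveP _ _ _ 'I_j) /(_ i0 i1).
  have := xS i0; have := xS i1; rewrite !inE /= => /eqP -> /eqP ->.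
  by move=> /(_ isT isT erefl).
(* This choice makes both error terms, [t * c * V] and [(m - 1) * t / (4 * c)], at most 1/4. The
   lost row is worth 1, which leaves room for [th <= 1/4]. *)
pose c : R := t%:R * m%:R.
have c0 : 0 < c by rewrite mulr_gt0; lra.
apply: (le_trans (ler_sum _ (fun r _ => rainbow_sum_le_dev (A r) S0 jt c0))).
rewrite -mulr_sumr ler_wpM2l ?(mulr_ge0, exprn_ge0, ltW G0)//.
rewrite big_split/= sumr_const cardC1 card_ord -mulr_sumr.
have mE : (m.-1)%:R = m%:R - 1 :> R by rewrite -subn1 natrB.
rewrite big_split/= -mulr_sumr sumr_const cardC1 card_ord -[(4 * c)^-1 *+ _]mulr_natl mE.
set V := \sum_(i < m | _) _.
have VD : V <= th.
  apply: le_trans (ltW hD); rewrite [leRHS](bigD1 r0)//= lerDr.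
  by apply: sumr_ge0 => b _; rewrite sqr_ge0.
have e1 : t%:R * (c * V) <= 4^-1.
  rewrite (_ : 4^-1 = t%:R * (c * th)); last first.
    by rewrite /c /th; field; apply/andP; split; rewrite gt_eqF//; lra.
  by rewrite !ler_wpM2l//; lra.
have e2 : t%:R * ((m%:R - 1) * (4 * c)^-1) <= 4^-1.
  rewrite (_ : _ * _ = 4^-1 * ((m%:R - 1) / m%:R)); last first.
    by rewrite /c; field; apply/andP; split; rewrite gt_eqF//; lra.
  by rewrite ler_piMr// ler_pdivrMr; lra.
have e3 : th <= 4^-1.
  rewrite -[leLHS]mul1r -[leRHS]mul1r.
  rewrite /th !mul1r lef_pV2 ?posrE ?mulr_gt0//; try lra.
  have : 1 <= t%:R ^+ 2 * m%:R :> R by rewrite mulr_ege1.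
  by lra.
lra.
Qed.

(** The gain from [exists_biased_set] is of order [n / m], whereas the columns of [x] excluded for
    [v] and the non-injective tuples cost at most order [m]. Hence [n] of order [m ^ 2] suffices. *)
Lemma SHF_ones_le_of_large (R : realType) (t j : nat) (la : R) :
  (1 < j)%N -> (j.+1 < t)%N -> la = ln ((t - j)%:R / ((t - j)%:R - 1)) ->
  exists C : R, forall m n (A : 'M['I_t]_(m, n)), (0 < m)%N -> (0 < n)%N ->
    is_SHF (fun _ : 'I_t => 1%N) A -> C * m%:R ^+ 2 <= n%:R ->
    n%:R <= ((t - j)%:R - 1) * expR (la * (gfrac R t j.+1 * m%:R)).
Proof.
move=> j1 jt laE; set g := gfrac R t j.+1.
have tp : 1 <= t%:R :> R by rewrite ler1n; lia.
have g0 : 0 < g by apply: gfrac_gt0; lia.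
have k1 : 1 < (t - j)%:R :> R by rewrite ltr1n; lia.
have la0 : 0 < la by rewrite laE ln_gt0// ltr_pdivlMr; lra.
have lg0 : 0 < la * g by rewrite mulr_gt0.
pose J : R := j%:R; have J0 : 0 <= J by [].
pose T : R := t%:R; have T1 : 1 <= T by [].
have T0 : 0 <= T by lra.
(* Chosen so that for [n = C1 * m ^ 2] the gain [la * g * th * n] equals
   [(J + (J + 2 * J ^ 2 * T) * (la * g)) * m]. *)
pose C1 := 4 * T ^+ 2 * (J + (J + 2 * J ^+ 2 * T) * (la * g)) / (la * g).
have C20 : 0 <= 2 * J ^+ 2 * T by rewrite !mulr_ge0 ?exprn_ge0.
have C10 : 0 <= C1.
  rewrite /C1 divr_ge0 ?(ltW lg0)// mulr_ge0 ?mulr_ge0 ?exprn_ge0//.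
  by rewrite addr_ge0// mulr_ge0 ?(ltW lg0)// addr_ge0.
exists (C1 + 2 * J ^+ 2 * T) => m n A m0 n0 SA hn.
have mp : 1 <= m%:R :> R by rewrite ler1n.
have mp2 : 1 <= m%:R ^+ 2 :> R by rewrite exprn_ege1.
have [S [nS S0 hT]] := exists_biased_set R A m0 n0 j1 (ltnW jt).
move: hT; rewrite -/g; set Tot := (\sum_(x in _) _)%:R => hT.
have := rainbow_rows_tangent S (g * m%:R) jt SA laE; rewrite -/Tot.
set B := (_ - 1) * _ => hB.
pose s : R := #|S|%:R; pose I : R := (#|S| ^_ j)%:R; pose P := s ^+ j.
have s0 : 0 < s by rewrite ltr0n.
have nS' : n%:R <= T * s by rewrite /T /s -natrM ler_nat.
(* This is what the second summand of the constant is for: at least half of the [j]-tuples in [S]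
   are then injective. *)
have sJ : 2 * J ^+ 2 <= s.
  have h : 2 * J ^+ 2 * T <= (C1 + 2 * J ^+ 2 * T) * m%:R ^+ 2.
    rewrite -[leLHS]mulr1 ler_pM//; lra.
  have : 2 * J ^+ 2 * T <= s * T by lra.
  by rewrite ler_pM2r//; lra.
have hsP : s * P <= s * I + J ^+ 2 * P.
  have := ge_ffact_expn #|S| j; rewrite -(ler_nat R) natrD !natrM !natrX.
  exact.
have P0 : 0 < P by rewrite exprn_gt0.
have PI : P <= 2 * I.
  have h : 2 * J ^+ 2 * P <= s * P by rewrite ler_wpM2r// ltW.
  have : s * P <= s * (2 * I) by lra.
  by rewrite ler_pM2l.
have I0 : 0 < I by lra.
have sPI : s * P <= I * (s + 2 * J ^+ 2).
  have h : J ^+ 2 * P <= J ^+ 2 * (2 * I) by rewrite ler_wpM2l// exprn_ge0.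
  lra.
set th := (4 * _ * _)^-1 in hT.
have t2p : 1 <= t%:R ^+ 2 :> R by rewrite exprn_ege1.
have th0 : 0 < th by rewrite invr_gt0 !mulr_gt0//; lra.
have thm : th <= m%:R.
  have h : 1 <= t%:R ^+ 2 * m%:R :> R by rewrite mulr_ege1.
  by rewrite (le_trans _ mp)// invf_le1; lra.
have hT' : Tot <= I * (n%:R * g * (m%:R - th) + 2 * J ^+ 2 * T * g * m%:R).
  rewrite -(ler_pM2l s0).
  have gm : 0 <= g * (m%:R - th) by rewrite mulr_ge0 ?subr_ge0// ltW.
  have h1 : s * Tot <= (s * P) * (n%:R * (g * (m%:R - th))).
    by rewrite -[leRHS]mulrA ler_pM2l//; apply: le_trans hT _; rewrite -/s -/P; lra.
  have h2 : (s * P) * (n%:R * (g * (m%:R - th))) <=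
      I * (s + 2 * J ^+ 2) * (n%:R * (g * (m%:R - th))).
    by rewrite ler_wpM2r// mulr_ge0.
  have h3 : 2 * J ^+ 2 * n%:R * (g * (m%:R - th)) <= 2 * J ^+ 2 * (T * s) * (g * (m%:R - th)).
    by rewrite ler_wpM2r// ler_wpM2l// mulr_ge0// exprn_ge0.
  have h4 : (2 * J ^+ 2 * T * s) * (g * (m%:R - th)) <= (2 * J ^+ 2 * T * s) * (g * m%:R).
    rewrite ler_wpM2l//; first by rewrite mulr_ge0// ltW.
    by rewrite ler_wpM2l ?(ltW g0)// gerBl ltW.
  have h5 : 2 * J ^+ 2 * n%:R * (g * (m%:R - th)) <= 2 * J ^+ 2 * T * s * (g * m%:R).
    by apply: le_trans h3 (le_trans _ h4); rewrite le_eqVlt; apply/orP; left; apply/eqP; ring.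
  have := ler_wpM2l (ltW I0) h5.
  lra.
have nj : n%:R - J <= (n - j)%:R.
  by rewrite /J lerBlDr -natrD ler_nat addnC -maxnE leq_maxr.
have la1 : 0 <= 1 + la * (g * m%:R) by rewrite addr_ge0// mulr_ge0 ?(ltW la0)// mulr_ge0// ltW.
have hB' : (n%:R - J) * (1 + la * (g * m%:R)) -
    la * (n%:R * g * (m%:R - th) + 2 * J ^+ 2 * T * g * m%:R) <= B.
  rewrite -(ler_pM2l I0); apply: le_trans hB.
  have h1 := ler_wpM2l (ltW I0) (ler_wpM2r la1 nj).
  have h2 := ler_wpM2l (ltW la0) hT'.
  rewrite -/I; lra.
suff : J + (J + 2 * J ^+ 2 * T) * (la * g) * m%:R <= la * g * th * n%:R by lra.
have h1 : C1 * m%:R ^+ 2 <= n%:R.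
  by apply: le_trans hn; rewrite ler_wpM2r ?exprn_ge0// lerDl.
have lgt : 0 <= la * g * th by rewrite mulr_ge0 ?(ltW lg0)// ltW.
apply: le_trans (ler_wpM2l lgt h1).
have -> : la * g * th * (C1 * m%:R ^+ 2) = (J + (J + 2 * J ^+ 2 * T) * (la * g)) * m%:R.
  by rewrite /th /C1 -/T; field; rewrite !gt_eqF//; lra.
rewrite [leRHS]mulrDl lerD2r -[leLHS]mulr1; exact: ler_wpM2l.
Qed.

(** * The cases [j = 0] and [j = 1], and the bound for all [j] *)

Lemma bernoulli_le (R : realType) (x : R) (k : nat) : 0 <= x ->
  1 + k%:R * x <= (1 + x) ^+ k.
Proof.
move=> x0; elim: k => [|k IH]; first by rewrite expr0 mul0r addr0.
have x1 : 0 <= 1 + x by lra.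
have := ler_wpM2l x1 IH; rewrite exprS -natr1 => /(le_trans _); apply.
have : 0 <= k%:R * x * x by rewrite !mulr_ge0.
lra.
Qed.

(** The classical strict decrease of [(1 + 1/n) ^ (n + 1)], from [n = k - 1] to [n = k]. It serves
    to compare the bounds for [j = 0] and [j = 1]. *)
Lemma exp_one_plus_inv_decr (R : realType) (k : nat) : (2 <= k)%N ->
  (k.+1%:R / k%:R) ^+ k.+1 < (k%:R / (k%:R - 1)) ^+ k :> R.
Proof.
move=> k2; have K : 2 <= k%:R :> R by rewrite ler_nat.
set x : R := k%:R in K *; rewrite -natr1 -/x.
have q : x / (x - 1) = (x + 1) / x * (1 + (x ^+ 2 - 1)^-1).
  by field; apply/and3P; split; apply/eqP; nra.
have z0 : 0 < x ^+ 2 - 1 by nra.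
rewrite q; have : 0 < (x + 1) / x by rewrite divr_gt0//; lra.
have -> : (x + 1) / x = 1 + x^-1 by field; apply/eqP; lra.
set y := 1 + x^-1 => y0; rewrite exprMn exprSr ltr_pM2l ?exprn_gt0//.
apply: lt_le_trans (bernoulli_le k _); last by rewrite invr_ge0 ltW.
rewrite -/x /y -subr_gt0 (_ : _ - _ = (x * (x ^+ 2 - 1))^-1).
  by rewrite invr_gt0 mulr_gt0//; lra.
by field; apply/andP; split; apply/eqP; nra.
Qed.

(** The case [j = 0]: [x] is the empty tuple, every row is rainbow for every [v], and all terms of
    the weighted sum are equal. *)
Lemma SHF_ones_le_weighted (R : realType) (m n t : nat) (A : 'M['I_t]_(m, n)) :
  (2 <= t)%N -> is_SHF (fun _ : 'I_t => 1%N) A ->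
  n%:R <= (t%:R - 1) * (t%:R / (t%:R - 1)) ^+ m :> R.
Proof.
move=> t2 SA; have T : 2 <= t%:R :> R by rewrite ler_nat.
pose x : {ffun 'I_0 -> 'I_n} := [ffun l : 'I_0 => False_rect 'I_n (notF (ltn_ord l))].
have xi : injective x by case.
have cx : codom x = [::] by apply: size0nil; rewrite size_codom card_ord.
have := rainbow_rows_sum_le R (ltnW t2) SA xi; rewrite cx subn0.
rewrite (eq_bigr (fun=> (1 - t%:R^-1) ^+ m)); last first.
  move=> v _; congr (_ ^+ _); rewrite /rainbow_rows.
  rewrite (eq_bigr (fun=> 1%N)); first by rewrite sum_nat_const card_ord muln1.
  by move=> r _; rewrite /rainbow cx.
rewrite sumr_const (_ : #|_| = n); last first.
  by rewrite -[RHS]card_ord; apply: eq_card => v; rewrite inE.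
have -> : 1 - t%:R^-1 = (t%:R / (t%:R - 1))^-1 :> R.
  by field; apply/andP; split; apply/eqP; lra.
by rewrite -[leLHS]mulr_natl exprVn ler_pdivrMr// exprn_gt0// divr_gt0//; lra.
Qed.

(** For [j >= 2], either [n] is at least quadratic in [m] and [SHF_ones_le_of_large] applies, or the
    exponential exceeds it anyway. For [j = 0] the weighted bound has no error terms, and it implies
    the case [j = 1] because its base is smaller. *)
Lemma SHF_ones_le (R : realType) (t j : nat) : (j.+1 < t)%N ->
  exists m0 : nat, forall m n (A : 'M['I_t]_(m, n)), (m0 <= m)%N ->
    is_SHF (fun _ : 'I_t => 1%N) A ->
    n%:R <= (t - j - 1)%:R *
      ((t - j)%:R / (t - j - 1)%:R) `^ (gfrac R t j.+1 * m%:R) :> R.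
Proof.
move=> jt; have k1 : 1 < (t - j)%:R :> R by rewrite ltr1n; lia.
have k2 : 2 <= (t - j)%:R :> R by rewrite ler_nat; lia.
have -> : (t - j - 1)%:R = (t - j)%:R - 1 :> R by rewrite natrB//; lia.
set a := (t - j)%:R / _.
have a1 : 1 < a by rewrite /a ltr_pdivlMr; lra.
have a0 : 0 < a by lra.
have G0 : 0 < gfrac R t j.+1 by apply: gfrac_gt0; lia.
have powE x : a `^ x = expR (x * ln a) by rewrite /powR gt_eqF.
have ag1 : 1 < a `^ gfrac R t j.+1 by rewrite powE expR_gt1 mulr_gt0 ?ln_gt0.
have powEm m : a `^ (gfrac R t j.+1 * m%:R) = (a `^ gfrac R t j.+1) ^+ m.
  by rewrite powRrM powR_mulrn// powR_ge0.
have [j1|j1] := ltnP 1 j.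
  have [C HC] := SHF_ones_le_of_large j1 jt (erefl (ln a)).
  have [m0 hm0] := natmul_exp_le C 2 ag1.
  exists m0.+1 => m n A hm SA.
  have [->|n0] := posnP n; first by rewrite mulr_ge0 ?powR_ge0//; lra.
  have [le|lt] := leP (C * m%:R ^+ 2) n%:R.
    apply: le_trans (HC m n A _ n0 SA le) _; first lia.
    by rewrite [ln a * _]mulrC -powE.
  apply: le_trans (ltW lt) _; apply: le_trans (hm0 m (ltnW hm)) _.
  by rewrite powEm ler_peMl ?exprn_ge0 ?powR_ge0//; lra.
have [e|j0] := posnP j.
  exists 0%N => m n A _ SA; rewrite powEm.
  rewrite /gfrac e ffactn1 expr1 divff ?pnatr_eq0; last lia.
  rewrite powRr1 ?(ltW a0)// /a e subn0; apply: (SHF_ones_le_weighted R _ SA); lia.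
have e : j = 1%N by lia.
move: a1 a0 ag1 powEm k1 k2 G0 {powE}; rewrite /a {a} e => a1 a0 ag1 powEm k1 k2 G0.
set T : R := t%:R; have tE : (t - 1)%:R = T - 1 by rewrite natrB//; lia.
rewrite tE in a1 a0 ag1 powEm k1 k2 *.
pose b := T / (T - 1); have b0 : 0 < b by rewrite divr_gt0//; lra.
pose d := ((T - 1) / (T - 1 - 1)) `^ gfrac R t 2.
have d0 : 0 < d by rewrite powR_gt0.
(* Raised to the power [t], this is [exp_one_plus_inv_decr] for [k = t - 1], since
   [t * g(t, 2) = t - 1]. *)
have bd : b < d.
  rewrite -(@ltr_pXn2r _ t) ?nnegrE ?ltW//; last lia.
  have -> : d ^+ t = ((T - 1) / (T - 1 - 1)) ^+ (t - 1).
    rewrite -powR_mulrn ?powR_ge0// -powRrM -powR_mulrn ?ltW//; congr (_ `^ _).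
    rewrite tE /gfrac ffactnS ffactn1 natrM -subn1 tE -/T.
    by field; apply/eqP; lra.
  have := @exp_one_plus_inv_decr R (t - 1); rewrite tE -subSn ?subn1 /=; try lia.
  by apply; lia.
(* The powers of [d / b] eventually outgrow the ratio of the leading constants [T - 1] and
   [T - 2]. *)
have db : 1 < d / b by rewrite ltr_pdivlMr// mul1r.
have [m0 hm0] := natmul_exp_le ((T - 1) / (T - 1 - 1)) 0 db.
exists m0 => m n A hm SA; rewrite powEm -/d.
have t2 : (1 < t)%N by lia.
apply: le_trans (SHF_ones_le_weighted R t2 SA) _; rewrite -/T -/b.
have := hm0 m hm; rewrite expr0 mulr1 expr_div_n ler_pdivlMr ?exprn_gt0//.
rewrite -(ler_pM2l (_ : 0 < T - 1 - 1)); last lra.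
by rewrite (_ : (T - 1 - 1) * (_ * _) = (T - 1) * b ^+ m)//; field; apply/eqP; lra.
Qed.

(** * Reduction to type {1, ..., 1} *)

(* [x : {ffun slots w -> 'I_n}] lists [w i - 1] columns for each part [i]. *)
Definition slots (t : nat) (w : 'I_t -> nat) : finType :=
  {i : 'I_t & 'I_(w i - 1)}.

Lemma card_slots (t : nat) (w : 'I_t -> nat) :
  #|{: slots w}| = (\sum_(i < t) (w i - 1))%N.
Proof.
rewrite card_tagged sumnE big_map big_enum.
by apply: eq_bigr => i _; rewrite card_ord.
Qed.

Definition separates (n t : nat) (w : 'I_t -> nat) (f : 'I_n -> 'I_t)
    (x : {ffun slots w -> 'I_n}) : bool :=
  [forall a, forall b, (tag a != tag b) ==> (f (x a) != f (x b))].

(** Every part has a slot, as [w i >= 2], and there are only [t] colours: representatives of the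
    parts use up all colours, so every part is monochromatic. *)
Lemma separates_perm (n t : nat) (w : 'I_t -> nat) (f : 'I_n -> 'I_t)
    (x : {ffun slots w -> 'I_n}) :
  (forall i, 1 < w i)%N -> separates f x ->
  exists p : 'S_t, forall a, f (x a) = p (tag a).
Proof.
move=> w1 sx.
have sP a b : tag a != tag b -> f (x a) != f (x b).
  by move: sx => /forallP/(_ a)/forallP/(_ b)/implyP.
have w0 i : (0 < w i - 1)%N by rewrite subn_gt0.
pose a0 i : slots w := Tagged (fun i => 'I_(w i - 1)) (Ordinal (w0 i)).
have hi : injective (fun i => f (x (a0 i))).
  by move=> i i' /eqP e; apply/eqP; apply: contraTT e => /(sP (a0 i) (a0 i')).
exists (perm hi) => a; rewrite permE.
have [i e] : exists i, f (x a) = perm hi i.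
  by exists ((perm hi)^-1 (f (x a)))%g; rewrite permKV.
rewrite e permE; have [->//|ne] := eqVneq i (tag a).
have := sP a (a0 i); rewrite eq_sym => /(_ ne) /negP; case.
by rewrite e permE.
Qed.

Lemma separates_count_le (n t : nat) (w : 'I_t -> nat) (f : 'I_n -> 'I_t)
    (S : {set 'I_n}) : (forall i, 1 < w i)%N ->
  (#|[set x : {ffun slots w -> 'I_n} | (x \in ffun_on (mem S)) && separates f x]%SET|
   <= \sum_(p : 'S_t) \prod_(i < t) #|[set y in S | f y == p i]%SET| ^ (w i - 1))%N.
Proof.
move=> w1.
pose Fm (p : 'S_t) (a : slots w) := [pred y | (y \in S) && (f y == p (tag a))].
have cF p : #|family (Fm p)| = (\prod_(i < t) #|[set y in S | f y == p i]%SET| ^ (w i - 1))%N.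
  rewrite card_family foldrE big_map big_enum/=.
  transitivity (\prod_(i < t) \prod_(l < w i - 1) #|[set y in S | f y == p i]%SET|)%N.
    rewrite (sig_big_dep xpredT (fun _ => xpredT) (fun i _ => #|[set y in S | f y == p i]%SET|))/=.
    by apply: eq_bigr => a _; rewrite cardsE.
  by apply: eq_bigr => i _; rewrite prod_nat_const card_ord.
pose X p := [set x : {ffun slots w -> 'I_n} | x \in family (Fm p)]%SET.
apply: (leq_trans (n := \sum_(x : {ffun slots w -> 'I_n}) \sum_(p : 'S_t) (x \in X p))).
  rewrite -sum1dep_card big_mkcond; apply: leq_sum => x _; case: ifP => //.
  move=> /andP[/ffun_onP xS /(separates_perm w1)[p pE]].
  rewrite (bigD1 p)//= (_ : x \in X p) ?leq_addr// inE; apply/familyP => a.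
  by rewrite inE /= xS pE eqxx.
rewrite exchange_big/=; apply: leq_sum => p _.
by rewrite -cF -(cardsE (family _)) -/(X p) -sum1_card [leqRHS]big_mkcond.
Qed.

Lemma pstar_ge (R : realType) (t : nat) (w : 'I_t -> nat) (p : 'I_t -> R) :
  (0 < t)%N -> (forall a, 0 <= p a) -> \sum_a p a = 1 -> sepfrac w p <= pstar R w.
Proof.
move=> t0 p0 p1; have [p' _ [-> ]] := pstar_max R w t0; apply; split=> // a.
by rewrite p0/= -p1 (bigD1 a)//= lerDl sumr_ge0.
Qed.

Lemma pstar_gt0 (R : realType) (t : nat) (w : 'I_t -> nat) :
  (0 < t)%N -> 0 < pstar R w.
Proof.
move=> t0; have tp : 0 < t%:R :> R by rewrite ltr0n.
apply: (lt_le_trans (y := sepfrac w (fun _ => t%:R^-1))).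
  have F : 0 < \prod_(i < t) t%:R^-1 ^+ (w i - 1) :> R.
    by apply: prodr_gt0 => i _; rewrite exprn_gt0// invr_gt0.
  rewrite /sepfrac (bigD1 1%g)//= ltr_wpDr // sumr_ge0// => s _.
  exact: ltW.
apply: pstar_ge => //.
by rewrite sumr_const card_ord -[LHS]mulr_natl divff// gt_eqF.
Qed.

Lemma separates_sum_le (R : realType) (n t : nat) (w : 'I_t -> nat)
    (f : 'I_n -> 'I_t) (S : {set 'I_n}) :
  (0 < t)%N -> (forall i, 1 < w i)%N -> (0 < #|S|)%N ->
  #|[set x : {ffun slots w -> 'I_n} | (x \in ffun_on (mem S)) && separates f x]%SET|%:R
   <= #|S|%:R ^+ (\sum_(i < t) (w i - 1)) * pstar R w.
Proof.
move=> t0 w1 S0.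
have := separates_count_le f S w1; rewrite -(ler_nat R) => /le_trans; apply.
apply: le_trans (ler_wpM2l _ (pstar_ge w t0 (@freq_ge0 R n t S f) (freq_sum R f S0))).
  rewrite /sepfrac mulr_sumr natr_sum; apply: ler_sum => p _.
  rewrite natr_prod -prodrXr -big_split/= le_eqVlt; apply/orP; left; apply/eqP.
  by apply: eq_bigr => i _; rewrite natrX -exprMn freq_natr.
by rewrite exprn_ge0.
Qed.

(** Average over the injective tuples in a colour class [S] of one row. That row separates none of
    them, so only [N - 1] rows count; with [#|S| >= s ^ 2 * N] the factor [(N - 1) / N] makes up for
    the share of non-injective tuples. *)
Lemma exists_rarely_separated (R : realType) (N n t : nat) (w : 'I_t -> nat)
    (A : 'M['I_t]_(N, n)) :
  let s := (\sum_(i < t) (w i - 1))%N in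
  (1 < t)%N -> (forall i, 1 < w i)%N -> (0 < N)%N -> (t * (s ^ 2 * N) <= n)%N ->
  exists2 x : {ffun slots w -> 'I_n}, injective x &
    #|[set r | separates (A r) x]%SET|%:R <= pstar R w * N%:R.
Proof.
move=> s t1 w1 N0 hn; have t0 := ltnW t1.
have ps0 := @pstar_gt0 R t w t0.
have w0 i : (0 < w i - 1)%N by rewrite subn_gt0.
pose r0 := Ordinal N0.
have [a ha] := exists_majority (A r0) t0.
set S := [set _ | _]%SET in ha.
have hS : (s ^ 2 * N <= #|S|)%N by have := leq_trans hn ha; rewrite leq_pmul2l.
have s0 : (0 < s)%N by rewrite /s (bigD1 (Ordinal t0))//= addn_gt0 w0.
have S0 : (0 < #|S|)%N by apply: leq_trans hS; rewrite muln_gt0 expn_gt0 s0.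
have sS : (s <= #|S|)%N by apply: leq_trans hS; rewrite -mulnA leq_pmulr// muln_gt0 s0.
pose cnt (x : {ffun slots w -> 'I_n}) := #|[set r | separates (A r) x]%SET|.
pose Q (x : {ffun slots w -> 'I_n}) := (x \in ffun_on (mem S)) && injectiveb x.
have cQ : #|[pred x | Q x]| = (#|S| ^_ s)%N.
  have := card_inj_ffuns_on (slots w) (mem S); rewrite card_slots => <-.
  by apply: eq_card => x; rewrite inE.
have I0 : (0 < #|S| ^_ s)%N by rewrite ffact_gt0.
apply: contrapT => H.
have lt : \sum_(x | Q x) pstar R w * N%:R < \sum_(x | Q x) (cnt x)%:R.
  apply: ltr_sum => [|x /andP[_ /injectiveP xi]].
    have : (0 < #|[pred x | Q x]|)%N by rewrite cQ.
    by case/card_gt0P => x xQ; apply/hasP; exists x => //; rewrite mem_index_enum.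
  by rewrite ltNge; apply/negP => h; apply: H; exists x.
have le : \sum_(x | Q x) (cnt x)%:R <= (N.-1)%:R * (#|S|%:R ^+ s * pstar R w).
  apply: (le_trans (y := \sum_(x : {ffun slots w -> 'I_n} | x \in ffun_on (mem S)) (cnt x)%:R)).
    rewrite big_mkcond [leRHS]big_mkcond/=; apply: ler_sum => x _.
    by rewrite /Q; case: (x \in _) => //=; case: ifP.
  rewrite -natr_sum (_ : (\sum_(x in _) _)%N = \sum_(r < N)
    #|[set x : {ffun slots w -> 'I_n} | (x \in ffun_on (mem S)) && separates (A r) x]%SET|)%N.
    rewrite (bigD1 r0)//= (_ : #|_| = 0%N) ?add0n.
      rewrite natr_sum; apply: (le_trans (ler_sum _ (fun r _ => separates_sum_le R (A r) t0 w1 S0))).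
      by rewrite sumr_const cardC1 card_ord mulr_natl.
    apply: eq_card0 => x; rewrite !inE; apply/negP => /andP[/ffun_onP xS].
    pose i0 := Ordinal t0; pose i1 := Ordinal t1.
    move=> /forallP/(_ (Tagged (fun i => 'I_(w i - 1)) (Ordinal (w0 i0)))).
    move=> /forallP/(_ (Tagged (fun i => 'I_(w i - 1)) (Ordinal (w0 i1)))).
    have := xS (Tagged (fun i => 'I_(w i - 1)) (Ordinal (w0 i0))).
    have := xS (Tagged (fun i => 'I_(w i - 1)) (Ordinal (w0 i1))).
    by rewrite !inE => /eqP -> /eqP ->; rewrite eqxx.
  rewrite (eq_bigr (fun x : {ffun slots w -> 'I_n} => \sum_(r < N) separates (A r) x)%N); last first.
    by move=> x _; rewrite /cnt -sum1dep_card big_mkcond.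
  rewrite exchange_big/=; apply: eq_bigr => r _.
  by rewrite -big_mkcondr/= sum1dep_card.
have : pstar R w * ((#|S| ^_ s)%:R * N%:R) < pstar R w * ((N.-1)%:R * #|S|%:R ^+ s).
  apply: le_lt_trans (lt_le_trans lt (le_trans le _)).
    by rewrite sumr_const cQ -[leRHS]mulr_natl mulrCA.
  by rewrite [leRHS]mulrCA [pstar R w * _]mulrC.
rewrite ltr_pM2l// -natrX -!natrM ltr_nat ltnNge => /negP; apply.
have := ge_ffact_expn #|S| s; move: hS.
set I := (_ ^_ _)%N; set P := (_ ^ s)%N; set z := #|S|.
move=> hS h.
have h1 : (N * (z * P) <= N * (z * I) + z * P)%N.
  have : (N * (z * P) <= N * (z * I + s ^ 2 * P))%N by rewrite leq_mul2l h orbT.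
  move/leq_trans; apply; rewrite mulnDr leq_add2l mulnA leq_mul2r.
  by rewrite mulnC hS orbT.
rewrite -(leq_pmul2l S0).
have e : (z * (N.-1 * P) + z * P = N * (z * P))%N.
  by rewrite -mulnDr -mulSnr prednK// mulnCA.
have : (z * (N.-1 * P) + z * P <= N * (z * I) + z * P)%N by rewrite e.
by rewrite leq_add2r [(N * (z * I))%N]mulnCA [(I * N)%N]mulnC.
Qed.

(** Add one further column to each part listed by [x]. A row separating the enlarged parts separates
    [x], hence is kept, and is injective on the added columns. *)
Lemma SHF_ones_of_SHF (N n m t : nat) (w : 'I_t -> nat) (A : 'M['I_t]_(N, n))
    (x : {ffun slots w -> 'I_n}) :
  (0 < N)%N -> (forall i, 1 < w i)%N -> is_SHF w A -> injective x ->
  (#|[set r | separates (A r) x]%SET| <= m)%N ->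
  exists B : 'M['I_t]_(m, n - \sum_(i < t) (w i - 1)), is_SHF (fun _ : 'I_t => 1%N) B.
Proof.
move=> N0 w1 SA xi Rm; pose D := [set y | y \notin codom x]%SET.
have cD : (n - \sum_(i < t) (w i - 1))%N = #|D|.
  rewrite -card_slots -(card_codom xi) /D -[X in (X - _)%N]card_ord -(cardC (mem (codom x))) addKn.
  by rewrite cardsE; apply: eq_card.
pose e k : 'I_n := enum_val (cast_ord cD k).
have ei : injective e by move=> k k' /enum_val_inj/cast_ord_inj.
have eD k : e k \notin codom x by have := enum_valP (cast_ord cD k); rewrite inE.
set R := [set r | _]%SET in Rm.
(* If fewer than [m] rows separate [x], the default of [nth] pads with copies of row 0, which does
   no harm. *)
exists (\matrix_(k, y) A (nth (Ordinal N0) (enum R) k) (e y)).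
apply: SHF_ones_of_injective => c ci.
pose X i := [set x (Tagged (fun i => 'I_(w i - 1)) l) | l : 'I_(w i - 1)]%SET.
pose C i := (e (c i) |: X i)%SET.
have XP i y : y \in X i -> exists2 a : slots w, tag a = i & y = x a.
  by case/imsetP => l _ ->; exists (Tagged (fun i => 'I_(w i - 1)) l).
have eX i i' : e (c i) \notin X i'.
  by apply/negP => /XP[a _ h]; have := eD (c i); rewrite h codom_f.
have [||r rP] := SA C.
- move=> i; rewrite cardsU1 eX card_imset ?card_ord; first by have := w1 i; lia.
  by move=> l l' /xi /eqP; rewrite eq_Tagged => /eqP.
- move=> i i' ne; apply/pred0P => y /=; rewrite !in_setU1; apply/negP.
  case/andP => /predU1P[->|yX] /predU1P[].
  + by move=> /ei/ci/eqP; rewrite (negbTE ne).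
  + by rewrite (negbTE (eX _ _)).
  + by move=> h; move: yX; rewrite h (negbTE (eX _ _)).
  + move: yX => /XP[b eb ->] /XP[b' eb' /xi h].
    by move: ne; rewrite -eb -eb' h eqxx.
have rD i i' y y' : i != i' -> y \in C i -> y' \in C i' -> A r y != A r y'.
  move=> ne yC yC'; apply/negP => /eqP h.
  have /pred0P/(_ (A r y)) := rP i i' ne.
  by rewrite /= imset_f// h imset_f.
have rR : r \in R.
  rewrite inE; apply/forallP => a; apply/forallP => b; apply/implyP => ne.
  apply: rD ne _ _; rewrite in_setU1; apply/orP; right.
    by case: a => i l /=; apply/imsetP; exists l.
  by case: b => i l /=; apply/imsetP; exists l.
have hk : (index r (enum R) < m)%N.
  by apply: leq_trans Rm; rewrite cardE index_mem mem_enum.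
exists (Ordinal hk) => i i'; rewrite !mxE /= nth_index ?mem_enum// => h.
apply/eqP/negPn/negP => ne.
by have := rD i i' _ _ ne (setU11 _ _) (setU11 _ _); rewrite h eqxx.
Qed.

(** For equal part sizes all permutations contribute the same power of the product of the [p i],
    which is largest at the uniform distribution by AM-GM. *)
Lemma pstar_const (R : realType) (t v : nat) : (0 < t)%N ->
  pstar R (fun _ : 'I_t => v) = t`!%:R * (1 / t%:R) ^+ (t * (v - 1)).
Proof.
move=> t0; have tp : 0 < t%:R :> R by rewrite ltr0n.
have E (p : 'I_t -> R) :
    sepfrac (fun _ : 'I_t => v) p = t`!%:R * (\prod_(i < t) p i) ^+ (v - 1).
  rewrite /sepfrac (eq_bigr (fun=> (\prod_(i < t) p i) ^+ (v - 1))).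
    by rewrite sumr_const card_Sn mulr_natl.
  move=> s _; rewrite prodrXl; congr (_ ^+ _).
  by rewrite [RHS](reindex_inj (@perm_inj _ s)).
apply/eqP; rewrite eq_le; apply/andP; split.
  have [p [p1 p01] [-> _]] := pstar_max R (fun _ : 'I_t => v) t0.
  have p0 i : 0 <= p i by have /andP[] := p01 i.
  rewrite E ler_wpM2l// exprM lerXn2r ?nnegrE ?exprn_ge0 ?prodr_ge0 ?divr_ge0//.
  have [h _] := @leif_AGM R 'I_t predT p (fun i _ => p0 i).
  by move: h; rewrite card_ord p1.
have := @pstar_ge R t (fun _ => v) (fun=> 1 / t%:R) t0; rewrite E.
rewrite prodr_const card_ord -exprM; apply; first by move=> _; rewrite divr_ge0.
by rewrite sumr_const card_ord -[LHS]mulr_natl mul1r divff// gt_eqF.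
Qed.

(** * Final bounds *)

(** The greedy construction allows exponentially many columns, in particular [K * m] of them. *)
Lemma exists_SHF_ones_linear (R : realType) (t K : nat) : (1 < t)%N -> exists m0 : nat,
  forall m, (m0 <= m)%N ->
    exists A : 'M['I_t]_(m, K * m), is_SHF (fun _ : 'I_t => 1%N) A.
Proof.
move=> t1; pose T := (t ^ t)%N.
have T4 : (1 < T)%N by rewrite /T -[X in (X < _)%N](exp1n t) ltn_exp2r// ltnW.
have Tp : 1 < T%:R :> R by rewrite ltr1n.
have a1 : 1 < T%:R / (T%:R - 1) :> R by rewrite ltr_pdivlMr; lra.
have [m0 hm0] := natmul_exp_le (K%:R ^+ t + 1) t a1.
exists m0.+1 => m hm; apply: exists_SHF_ones; first exact: ltnW.
rewrite -/T; clearbody T; rewrite -(ltr_nat R) natrM !natrX natrM natrB ?(ltnW T4)// exprMn.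
have mp : 0 < m%:R ^+ t :> R by rewrite exprn_gt0// ltr0n; lia.
have := hm0 m (ltnW hm); rewrite expr_div_n ler_pdivlMr ?exprn_gt0//; last lra.
move=> /(lt_le_trans _); apply; rewrite mulrC ltr_pM2r ?exprn_gt0//; last lra.
by rewrite ltr_pM2r//; lra.
Qed.

(** If the largest [n] exceeded [M + s], the linear lower bound on [M] would make it large compared
    with [N]; deleting a rarely separated tuple would then leave an SHF with [m] rows and more than
    [M] columns. *)
Lemma maxcols_le (R : realType) (t : nat) (w : 'I_t -> nat) :
  (1 < t)%N -> (forall i, 1 < w i)%N ->
  exists N0 : nat, forall N, (N0 <= N)%N ->
    (maxcols R N t w <= maxcolsr (pstar R w * N%:R) t (fun _ : 'I_t => 1%N)
       + ((\sum_(i < t) w i)%N%:R - t%:R)%:E)%E.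
Proof.
move=> t1 w1; have ps0 := @pstar_gt0 R t w (ltnW t1).
set ps := pstar R w in ps0 *; pose s := (\sum_(i < t) (w i - 1))%N.
(* The factor 2 makes up for rounding [ps * N] down to [m], so that [K * m >= t * s ^ 2 * N]. *)
pose K := (Num.truncn (2 * (t * s ^ 2)%:R / ps)).+1.
have KP : 2 * (t * s ^ 2)%:R <= K%:R * ps.
  by rewrite -ler_pdivrMr//; apply/ltW/truncnS_gt.
have [m0 hm0] := exists_SHF_ones_linear R K t1.
exists (Num.truncn (m0.+1%:R / ps)).+1 => N hN.
have hpN : m0.+1%:R <= ps * N%:R.
  rewrite mulrC -ler_pdivrMr//; apply: le_trans (ltW (truncnS_gt _)) _.
  by rewrite ler_nat.
have N0 : (0 < N)%N by apply: leq_trans hN.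
rewrite /maxcolsr; set m := Num.truncn (ps * N%:R).
have pN0 : 0 <= ps * N%:R by rewrite mulr_ge0// ltW.
have mm0 : (m0 < m)%N by rewrite truncn_gt_nat.
have [M [-> _ HM]] := @maxcols_max R m t t (fun=> 1%N) t1 (fun=> isT).
have [n [-> [A SA] _]] := maxcols_max R N t t1 (fun i => ltnW (w1 i)).
have uE : (\sum_(i < t) w i)%N%:R - t%:R = s%:R :> R.
  apply/eqP; rewrite subr_eq -natrD; apply/eqP; congr (_%:R).
  rewrite /s -[X in (_ + X)%N]card_ord -sum1_card -big_split/=.
  by apply: eq_bigr => i _; rewrite subnK// ltnW.
rewrite uE -EFinD lee_fin -natrD ler_nat leqNgt; apply/negP => lt.
have hn : (t * (s ^ 2 * N) <= n)%N.
  have [B SB] := hm0 m (ltnW mm0).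
  apply: leq_trans (leq_trans (HM _ _ SB) (leq_trans (leq_addr s M) (ltnW lt))).
  rewrite mulnA -(ler_nat R) !(natrM _ _ N) (natrM _ K).
  have h1 : ps * N%:R <= 2 * m%:R.
    apply: le_trans (ltW (truncnS_gt _)) _; rewrite -/m -natrM ler_nat; lia.
  have h2 := ler_wpM2r (ler0n R N) KP.
  have h3 := ler_wpM2l (ler0n R K) h1.
  set z := (t * s ^ 2)%:R in h2 *; lra.
have [x xi hx] := exists_rarely_separated R A t1 w1 N0 hn.
have [|B SB] := SHF_ones_of_SHF (m := m) N0 w1 SA xi.
  by rewrite truncn_ge_nat.
have := HM _ _ SB; rewrite -/s; lia.
Qed.

Lemma maxcolsr_ones_le (R : realType) (t j : nat) : (j.+1 < t)%N ->
  exists x0 : R, forall x, x0 <= x ->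
    (maxcolsr x t (fun _ : 'I_t => 1%N) <= ((t - j - 1)%:R *
      ((t - j)%:R / (t - j - 1)%:R) `^ (gfrac R t j.+1 * x))%:E)%E.
Proof.
move=> jt; have [m0 hm0] := SHF_ones_le R jt.
exists m0%:R => x hx; have x0 : 0 <= x by apply: le_trans hx.
apply: ge_ereal_sup => _ [n [A SA] <-]; rewrite lee_fin.
apply: le_trans (hm0 _ _ A _ SA) _; first by rewrite truncn_ge_nat.
apply: ler_wpM2l => //; apply: ler_powR.
  by rewrite ler_pdivlMr ?mul1r ?ler_nat ?ltr0n; lia.
rewrite ler_wpM2l ?truncn_le//; apply/ltW/gfrac_gt0; lia.
Qed.

Lemma maxcolsr_ones_le_bounds (R : realType) (t : nat) :
  exists x0 : R, forall x, x0 <= x -> forall j, (j.+1 < t)%N ->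
    (maxcolsr x t (fun _ : 'I_t => 1%N) <= ((t - j - 1)%:R *
      ((t - j)%:R / (t - j - 1)%:R) `^ (gfrac R t j.+1 * x))%:E)%E.
Proof.
have /choice[f fP] : forall j : 'I_(t.-1), exists x0 : R, forall x, x0 <= x ->
    (maxcolsr x t (fun _ : 'I_t => 1%N) <= ((t - j - 1)%:R *
      ((t - j)%:R / (t - j - 1)%:R) `^ (gfrac R t j.+1 * x))%:E)%E.
  by move=> j; apply: maxcolsr_ones_le; have := ltn_ord j; lia.
exists (\sum_j `|f j|) => x hx j jt.
have jt' : (j < t.-1)%N by lia.
apply: (fP (Ordinal jt')); apply: le_trans hx.
by rewrite (bigD1 (Ordinal jt'))//= ler_wpDr ?sumr_ge0// ler_norm.
Qed.

Lemma maxcols_one_part (R : realType) (N q : nat) (w : 'I_1 -> nat) :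
  (0 < N)%N -> (0 < q)%N -> maxcols R N q w = +oo%E.
Proof.
move=> N0 q0; apply: eq_infty => r.
apply: (le_trans (y := (Num.truncn r).+1%:R%:E)); first exact/ltW/truncnS_gt.
apply: ereal_sup_ubound; exists (Num.truncn r).+1 => //.
exists (\matrix_(_, _) Ordinal q0) => C _ _; exists (Ordinal N0) => i i'.
by rewrite !ord1 eqxx.
Qed.

Lemma SHF_rows_gt0 (n q t : nat) (w : 'I_t -> nat) (N : nat) (A : 'M['I_q]_(N, n)) :
  is_SHF w A -> (\sum_(i < t) w i <= n)%N -> (0 < N)%N.
Proof.
move=> SA hn.
have [|C [C1 _ C3]] := disjoint_family (enum_uniq 'I_t) (X := [set: 'I_n]%SET) (w := w).
  by rewrite big_enum cardsT card_ord.
have [r _] := SA C (fun i => C1 i (mem_enum _ i)) C3.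
by apply: leq_ltn_trans (ltn_ord r).
Qed.

Theorem theorem5p1 (R : realType) (t : nat) (w : 'I_t -> nat)
    (ht : (0 < t)%N) (hw : forall i, (2 <= w i)%N) :
  let u := (\sum_(i < t) w i)%N in
  let ps := pstar R w in
  exists n0 : nat,
  forall (N n : nat) (F : 'M['I_t]_(N, n)),
    is_SHF w F -> (n0 <= n)%N ->
    ((maxcols R N t w <=
        maxcolsr (ps * N%:R) t (fun _ : 'I_t => 1%N) + (u%:R - t%:R)%:E)%E /\
     (maxcolsr (ps * N%:R) t (fun _ : 'I_t => 1%N) + (u%:R - t%:R)%:E <=
        \big[Order.min/+oo]_(j < t.-1)
          ((t - j - 1)%:R *
           ((t - j)%:R / (t - j - 1)%:R) `^ (gfrac R t j.+1 * ps * N%:R))%:E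
        + (u%:R - t%:R)%:E)%E) /\
    (forall v : nat, (forall i, w i = v) ->
     let x := t`!%:R * (1 / t%:R) ^+ (t * (v - 1)) * N%:R : R in
     (maxcols R N t (fun _ : 'I_t => v) <=
        maxcolsr x t (fun _ : 'I_t => 1%N) + (u%:R - t%:R)%:E)%E /\
     ((2 <= t)%N ->
      (maxcolsr x t (fun _ : 'I_t => 1%N) + (u%:R - t%:R)%:E <=
        (Order.min
           (2 `^ (t`!%:R ^+ 2 * N%:R / t%:R ^+ (t * v - 1)))
           ((t - 1)%:R *
            (t%:R / (t - 1)%:R) `^ (t`!%:R * N%:R / t%:R ^+ (t * v - t))))%:E
        + (u%:R - t%:R)%:E)%E)).
Proof.
move=> u ps.
have [t1|t2] := leqP t 1.
  have {t1} e : t = 1%N by lia.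
  move: w hw @u @ps; rewrite e => {t ht e} w hw u ps.
  exists u => N n F SF hn; have N0 := SHF_rows_gt0 SF hn.
  (* For [t = 1] every right-hand side is infinite: [ps * N >= 1] leaves at least one row, and the
     minimum over no [j] is [+oo]. *)
  have top y (w' : 'I_1 -> nat) : 1 <= y -> maxcolsr y 1 w' = +oo%E :> \bar R.
    by move=> y1; rewrite /maxcolsr maxcols_one_part// truncn_gt0.
  have ps1 : 1 <= ps.
    have := @pstar_ge R 1 w (fun=> 1) isT (fun=> ler01).
    rewrite sumr_const card_ord => /(_ erefl); apply: le_trans.
    rewrite /sepfrac (eq_bigr (fun=> 1)) => [|s _]; first by rewrite sumr_const card_Sn.
    by rewrite big1// => i _; rewrite expr1n.
  have N1 : 1 <= N%:R :> R by rewrite ler1n.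
  split; first by rewrite top ?mulr_ege1// big_ord0 addye// !leey.
  move=> v _ x; split=> //; rewrite top ?addye ?leey//.
  by rewrite /x divr1 expr1n mulr1 factS mul1r.
have [N1 hN1] := maxcols_le R t2 hw.
have [x0 hx0] := maxcolsr_ones_le_bounds R t.
have ps0 : 0 < ps by apply: pstar_gt0.
pose N2 := (Num.truncn (x0 / ps)).+1.
(* Since [n <= t ^ N * u], so many columns force [N >= N1 + N2]. *)
exists (t ^ (N1 + N2) * u).+1 => N n F SF hn.
have hN : (N1 + N2 <= N)%N.
  rewrite leqNgt; apply/negP => lt.
  have := SHF_bounded t2 (fun i => ltnW (hw i)) SF.
  rewrite card_mx card_ord muln1 -/u leqNgt => /negP; apply.
  by apply: leq_ltn_trans hn; rewrite leq_mul2r leq_exp2l// (ltnW lt) orbT.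
have hx : x0 <= ps * N%:R.
  rewrite mulrC -ler_pdivrMr//; apply: le_trans (ltW (truncnS_gt _)) _.
  by rewrite ler_nat; apply: leq_trans hN; rewrite leq_addl.
have le1 := hN1 N (leq_trans (leq_addr _ _) hN).
split.
  split=> //; apply: leeD2r; apply: le_bigmin => [|j _]; first exact: leey.
  rewrite -mulrA; apply: hx0 => //; have := ltn_ord j; lia.
move=> v hv x; have wE : w = fun=> v by apply/funext => i; exact: hv.
have xE : x = ps * N%:R by rewrite /x /ps wE pstar_const.
have v2 : (2 <= v)%N by rewrite -(hv (Ordinal ht)).
have tn : t%:R != 0 :> R by rewrite pnatr_eq0 -lt0n.
split; first by rewrite xE -wE.
move=> _; rewrite xE; apply: leeD2r; rewrite EFin_min le_min; apply/andP; split.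
  (* The choice [j = t - 2] has base 2 and leading factor 1. *)
  have := hx0 _ hx (t - 2)%N; rewrite -xE.
  have -> : (t - (t - 2) - 1 = 1)%N by lia.
  have -> : (t - (t - 2) = 2)%N by lia.
  have -> : ((t - 2).+1 = t - 1)%N by lia.
  rewrite mul1r divr1.
  have -> : gfrac R t (t - 1)%N * x = t`!%:R ^+ 2 * N%:R / t%:R ^+ (t * v - 1).
    have -> : (t * v - 1 = (t - 1) + t * (v - 1))%N by nia.
    rewrite /gfrac -(@ffact_fact t (t - 1)%N); last lia.
    have -> : (t - (t - 1) = 1)%N by lia.
    rewrite /x -(@ffact_fact t (t - 1)%N); last lia.
    have -> : (t - (t - 1) = 1)%N by lia.
    rewrite (_ : 1`! = 1%N)// muln1 exprD expr_div_n expr1n; field.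
    by rewrite !expf_neq0.
  by apply; lia.
(* The choice [j = 0], where [g(t, 1) = 1]. *)
have := hx0 _ hx 0%N t2; rewrite -xE subn0.
rewrite (_ : gfrac R t 1 * x = t`!%:R * N%:R / t%:R ^+ (t * v - t))//.
rewrite /gfrac ffactn1 expr1 divff// mul1r /x.
have -> : (t * v - t = t * (v - 1))%N by rewrite mulnBr muln1.
by rewrite expr_div_n expr1n; field; rewrite expf_neq0.
Qed.
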